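(* Let $d\ge1$ be a fixed integer. There is a constant $C$ (depending only on $d$) such that for all $n>2d$ with $nd$ even the following holds. Let $m=\frac{nd}{2}$, and let $X$ be the number of crossings in a uniformly random embedding of a uniformly random $d$-regular simple graph on the vertex set $[n]$. Let $\mu=\frac{m(m-2d+1)}{6}$ and let $Z\sim N\left(\mu,\frac{m^3}{45}\right)$. Then $$d_K(X,Z)\le\frac{C}{\sqrt n}.$$ In particular, $X$ (suitably normalized) is asymptotically normal as $n\to\infty$.
   Context: Let $G=(V,E)$ be a finite simple graph with vertex set $V=[n]=\{1,\dots,n\}$. For a permutation $\pi\in S_n$, the embedding $G_\pi$ is the graph on $[n]$ in which $(\pi(v),\pi(w))$ is an edge if and only if $(v,w)\in E$. A crossing in $G_\pi$ is a quadruple $(a,b,c,d)$ of vertices with $(a,b),(c,d)\in E$ and $\pi(a)>\pi(c)>\pi(b)>\pi(d)$. A uniformly random embedding of $G$ is $G_\pi$ with $\pi$ uniformly random in $S_n$; for a random graph, $\pi$ is independent of the graph. The Kolmogorov distance between real random variables is $d_K(X,Y)=\sup_{x\in\mathbb{R}}|P(X\le x)-P(Y\le x)|$. *)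

(* Defs.v *)
From HB Require Import structures.
From mathcomp Require Export all_boot all_order all_algebra all_fingroup.
From mathcomp Require Export all_classical all_reals all_analysis.

Set Implicit Arguments.
Unset Strict Implicit.
Unset Printing Implicit Defensive.

Import Order.TTheory GRing.Theory Num.Theory.

Local Open Scope ring_scope.

(* A graph on a finite vertex set is its set of ordered adjacent pairs, so each
   edge {v, w} of a simple graph is recorded twice, as (v, w) and (w, v). *)
Definition simple_graph (V : finType) (E : {set V * V}) : bool :=
  [forall v, (v, v) \notin E] &&
  [forall v, forall w, ((v, w) \in E) == ((w, v) \in E)].

Definition degree (V : finType) (E : {set V * V}) (v : V) : nat :=
  #|[set w | (v, w) \in E]%SET|.

Definition regular_graphs (n d : nat) : {set {set 'I_n * 'I_n}} :=
  [set E | simple_graph E && [forall v, degree E v == d]]%SET.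

(* The strict inequalities orient both edges, so each crossing pair of edges
   gives exactly one quadruple. *)
Definition crossings (n : nat) (E : {set 'I_n * 'I_n}) (p : {perm 'I_n}) : nat :=
  #|[set q : 'I_n * 'I_n * 'I_n * 'I_n |
      let: (a, b, c, d) := q in
      [&& (a, b) \in E, (c, d) \in E &
          (p d < p b)%N && (p b < p c)%N && (p c < p a)%N]]%SET|.

Local Open Scope classical_set_scope.

(* U carries no sigma-algebra: the measurability of Y for the discrete one is
   part of the definition. *)
Definition uniform_on (R : realType) (dT : measure_display)
    (T : measurableType dT) (P : probability T R) (U : finType)
    (A : {set U}) (Y : T -> U) : Prop :=
  forall u : U, measurable (Y @^-1` [set u]) /\
    P (Y @^-1` [set u]) = (if u \in A then #|A|%:R^-1 else 0)%:E.

(* As U and V are finite, testing single values gives full independence. *)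
Definition independent_finite (R : realType) (dT : measure_display)
    (T : measurableType dT) (P : probability T R) (U V : finType)
    (Y : T -> U) (Z : T -> V) : Prop :=
  forall (u : U) (v : V),
    P (Y @^-1` [set u] `&` Z @^-1` [set v]) =
    (P (Y @^-1` [set u]) * P (Z @^-1` [set v]))%E.

Definition random_regular_crossings (R : realType) (n d : nat)
    (dT : measure_display) (T : measurableType dT) (P : probability T R)
    (X : {RV P >-> R}) : Prop :=
  exists (G : T -> {set 'I_n * 'I_n}) (p : T -> {perm 'I_n}),
    [/\ uniform_on P (regular_graphs n d) G,
        uniform_on P [set: {perm 'I_n}]%SET p,
        independent_finite P G p &
        forall w : T, X w = (crossings (G w) (p w))%:R].

(* Z has law N(mu, sigma^2).  Only measurable sets are tested: [distribution]
   and [normal_prob] are also defined, but meaningless, on the other ones. *)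
Definition normal_law (R : realType) (dT : measure_display)
    (T : measurableType dT) (P : probability T R) (Z : {RV P >-> R})
    (mu sigma : R) : Prop :=
  forall A : set R, measurable A -> distribution P Z A = normal_prob mu sigma A.

Definition kolmogorov_distance (R : realType)
    (d1 : measure_display) (T1 : measurableType d1) (P1 : probability T1 R)
    (d2 : measure_display) (T2 : measurableType d2) (P2 : probability T2 R)
    (X : {RV P1 >-> R}) (Y : {RV P2 >-> R}) : \bar R :=
  ereal_sup (range (fun x : R => `|cdf X x - cdf Y x|%E)).

Definition edge_number (R : realType) (n d : nat) : R := (n * d)%:R / 2.

Definition crossing_mean (R : realType) (n d : nat) : R :=
  let m := edge_number R n d in m * (m - 2 * d%:R + 1) / 6.

(* The standard deviation: [normal_prob] takes it in place of the variance. *)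
Definition crossing_sd (R : realType) (n d : nat) : R :=
  Num.sqrt (edge_number R n d ^+ 3 / 45).

(* Main.v *)
Require Import Defs.
From HB Require Import structures.
From mathcomp Require Import zify ring lra.

Set Implicit Arguments.
Unset Strict Implicit.
Unset Printing Implicit Defensive.

Import Order.TTheory GRing.Theory Num.Theory.
Import numFieldNormedType.Exports.

Local Open Scope classical_set_scope.
Local Open Scope ring_scope.

(** It suffices to treat one fixed d-regular graph with a uniformly random
    permutation, with a bound that does not depend on the graph; the random
    graph is then a mixture of such cases, with the same mean and the same
    normalisation.

    The positions of the vertices may be replaced by independent uniform points
    of a discrete circle of N = n ^ 3 points.  When these points are distinct
    they are ordered like a uniform permutation, and a collision has
    probability at most n ^ 2 / N = 1 / n ([mean_crossX_crossings]).

    For independent positions, the number X of crossings splits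
    ([crossX_decomp]) as X = E X + L + Q.  Given an edge whose ends are at
    relative circular distance p, another disjoint edge crosses it with
    probability 2 p (1 - p); L collects these first-order contributions, and is
    a sum over edges of pairwise uncorrelated terms, whence the variance
    m ^ 3 / 45 up to O(n ^ 2) ([mean_linpart_sqr]).  In Q each pair of edges
    contributes a term that is centred given either of the two edges; two such
    terms are correlated only if each edge of one meets the other pair, and
    only O(n ^ 2) couples of pairs are so placed ([second_moment]).

    Resampling the position of one random vertex yields an exchangeable pair.
    A term of L depends exactly on two vertices and is centred given one of
    them, so L has drift exactly - (2 / n) L, and Q only adds O(1) to the drift
    of X ([resample_drift]): this is an approximate linear regression with rate
    lambda = 2 / n.  One resampling moves X by O(n), hence the normalised count
    by O(1 / sqrt n), and the sum over the vertices of the squared increments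
    has differences O(n ^ 2), so it concentrates by the Efron-Stein inequality
    ([efron_stein], [bounded_diff_sqincr]).

    Stein's method for exchangeable pairs with bounded increments
    ([stein_exchangeable]) turns these estimates into a Kolmogorov bound
    O(1 / sqrt n).  It rests on Stein's equation for indicators of half-lines
    ([stein_eq], [stein_taylor]). *)

(** * Mean value theorem *)

Section Calculus.
Variable R : realType.
Implicit Types (f df : R -> R) (a b x y z : R).

(** The derivative is only controlled on a half-line: the tail estimate
    [Phi_tail] differentiates a quotient by - t, which is singular at 0. *)
Lemma mvt_below f df z x y :
  (forall t, t <= z -> is_derive t 1 f (df t)) -> x <= z -> y <= z ->
  exists c, [/\ Num.min x y <= c, c <= Num.max x y &
                f y - f x = df c * (y - x)].
Proof.
move=> fd.
have main a b : a <= b -> b <= z ->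
    exists c, [/\ a <= c, c <= b & f b - f a = df c * (b - a)].
  move=> ab bz; have [||c] := @MVT_segment R f df a b ab.
  - move=> t; rewrite in_itv /= => /andP[_ tb].
    by apply: fd; rewrite (le_trans (ltW tb)).
  - apply: derivable_within_continuous => t; rewrite in_itv /= => /andP[_ tb].
    by have [] := fd t (le_trans tb bz).
  - by rewrite in_itv /= => /andP[ac cb] e; exists c.
move=> xz yz; case: (leP x y) => [xy|yx].
  by have [c [? ? ?]] := main _ _ xy yz; exists c.
have [c [? ? e]] := main _ _ (ltW yx) xz; exists c; split=> //.
by rewrite -opprB e; ring.
Qed.

Lemma derive_ge0_homo f df z x y :
  (forall t, t <= z -> is_derive t 1 f (df t)) ->
  (forall t, t <= z -> 0 <= df t) -> x <= y -> y <= z -> f x <= f y.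
Proof.
move=> fd df0 xy yz.
have [c [_ cy e]] := mvt_below fd (le_trans xy yz) yz.
rewrite -subr_ge0 e mulr_ge0 ?subr_ge0// df0// (le_trans cy)//.
by rewrite ge_max yz (le_trans xy).
Qed.

Lemma derive0_cst f : (forall t : R, is_derive t 1 f (0 : R)) -> forall x y, f x = f y.
Proof.
move=> fd x y.
have mx : x <= Num.max x y by rewrite le_max lexx.
have my : y <= Num.max x y by rewrite le_max lexx orbT.
have [c [_ _ e]] := @mvt_below f (cst 0) _ x y (fun t _ => fd t) mx my.
by apply/esym/subr0_eq; rewrite e mul0r.
Qed.

End Calculus.

(** * The normal distribution function *)

Section NormalCdf.
Variable R : realType.
Implicit Types (m s x : R).

Definition ncdf m s x : R := fine (normal_prob m s `]-oo, x]).

Lemma ncdfE m s x : normal_prob m s `]-oo, x] = (ncdf m s x)%:E.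
Proof. by rewrite fineK ?fin_num_measure. Qed.

Lemma ncdf_ge0 m s x : 0 <= ncdf m s x.
Proof. by rewrite -lee_fin -ncdfE. Qed.

Lemma ncdf_le1 m s x : ncdf m s x <= 1.
Proof. by rewrite -lee_fin -ncdfE probability_le1. Qed.

Lemma is_derive_ncdf m s x : s != 0 ->
  is_derive x 1 (ncdf m s) (normal_pdf m s x).
Proof.
move=> s0.
have [||||d e] := @continuous_FTC1 R (normal_pdf m s) -oo%O x (x + 1).
- by rewrite ltrDl.
- by apply: integrableS (integrable_normal_pdf m s).
- by rewrite ltNyr.
- exact: continuous_normal_pdf.
- by apply: DeriveDef; [exact: d|rewrite -derive1E].
Qed.

Let idTR : measurableTypeR R -> R := idfun.

#[local] HB.instance Definition _ :=
  @isMeasurableFun.Build _ _ _ _ idTR (@measurable_id _ _ setT).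

Lemma ncdf_cvgNy m s : ncdf m s x @[x --> -oo] --> (0 : R).
Proof.
exact/fine_cvg/(cvg_cdfNy0 (idTR : {RV (normal_prob m s) >-> R})).
Qed.

Lemma ncdf_cvgy m s : ncdf m s x @[x --> +oo] --> (1 : R).
Proof.
exact/fine_cvg/(cvg_cdfy1 (idTR : {RV (normal_prob m s) >-> R})).
Qed.

Lemma ncdf_lt_eps m s (e : R) : 0 < e ->
  exists M : R, forall y : R, y <= M -> ncdf m s y < e.
Proof.
move=> e0.
have /cvgrPdist_lt /(_ e e0) [M [_ MP]] := @ncdf_cvgNy m s.
have P y : y < M -> ncdf m s y < e.
  move=> yM; have := MP y yM.
  by rewrite /= sub0r normrN ger0_norm ?ncdf_ge0.
exists (M - 1) => y h.
by apply: P; rewrite (le_lt_trans h)// ltrBlDr ltrDl.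
Qed.

Definition stdpdf (x : R) := normal_pdf 0 1 x.

Lemma stdpdfE x : stdpdf x = normal_peak 1 * expR (- (x ^+ 2 / 2)).
Proof.
rewrite /stdpdf normal_pdfE ?oner_neq0// /normal_fun subr0 expr1n.
by rewrite mulNr.
Qed.

Lemma stdpdf_gt0 x : 0 < stdpdf x.
Proof. by rewrite stdpdfE mulr_gt0 ?expR_gt0// normal_peak_gt0// oner_neq0. Qed.

Lemma stdpdfN x : stdpdf (- x) = stdpdf x.
Proof. by rewrite !stdpdfE sqrrN. Qed.

Lemma is_derive_stdpdf x : is_derive x 1 stdpdf (- x * stdpdf x).
Proof.
have -> : stdpdf = (fun x => normal_peak 1 * expR (- (x ^+ 2 / 2))).
  by apply/funext => y; rewrite stdpdfE.
apply: is_derive_eq.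
by rewrite /GRing.scale /=; field.
Qed.

Lemma normal_pdf_scale m s x : 0 < s ->
  normal_pdf m s x = stdpdf ((x - m) / s) / s.
Proof.
move=> s0; rewrite stdpdfE normal_pdfE ?gt_eqF// /normal_fun /normal_peak.
rewrite expr1n mul1r.
have -> : Num.sqrt (s ^+ 2 * pi *+ 2) = s * Num.sqrt (pi *+ 2) :> R.
  by rewrite -mulrnAr sqrtrM ?sqr_ge0// sqrtr_sqr gtr0_norm.
have e : (x - m) ^+ 2 / (s ^+ 2 *+ 2) = ((x - m) / s) ^+ 2 / 2.
  by rewrite -mulr_natr; field; rewrite gt_eqF.
by rewrite invfM mulNr e; ring.
Qed.

(** Both sides have the same derivative and tend to 0 at -oo. *)
Lemma ncdf_scale m s x : 0 < s -> ncdf m s x = ncdf 0 1 ((x - m) / s).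
Proof.
move=> s0; apply/eqP; rewrite -subr_eq0; apply/eqP.
pose f x := ncdf m s x - ncdf 0 1 ((x - m) / s).
have fd (t : R) : is_derive t 1 f (0 : R).
  have d1 := is_derive_ncdf m t (lt0r_neq0 s0).
  have d2 := is_derive_ncdf 0 ((t - m) / s) (oner_neq0 R).
  have d3 : is_derive t 1 (fun t => (t - m) / s) (s^-1).
    apply: is_derive_eq; rewrite /GRing.scale /=; ring.
  have d4 : is_derive t 1 (ncdf 0 1 \o (fun t => (t - m) / s))
      (normal_pdf 0 1 ((t - m) / s) * s^-1) by exact: is_derive1_comp.
  have d5 := is_deriveB d1 d4.
  apply: is_derive_eq.
  rewrite normal_pdf_scale//; rewrite /GRing.scale /= /stdpdf; ring.
have fx := derive0_cst fd x.
apply/eqP; rewrite -normr_le0; apply/ler_addgt0Pl => e e0; rewrite addr0.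
have [y1 h1] := ncdf_lt_eps m s e0.
have [y2 h2] := ncdf_lt_eps 0 1 e0.
rewrite -/(f x) (fx (Num.min y1 (s * y2 + m))) /f.
set y := Num.min _ _.
have {}h1 := h1 y; have {}h2 := h2 ((y - m) / s).
have k1 : ncdf m s y < e by apply: h1; rewrite ge_min lexx.
have k2 : ncdf 0 1 ((y - m) / s) < e.
  apply: h2; rewrite ler_pdivrMr// lerBlDr mulrC.
  by rewrite ge_min lexx orbT.
move: k1 k2 (ncdf_ge0 m s y) (ncdf_ge0 0 1 ((y - m) / s)).
move: (ncdf m s y) (ncdf 0 1 ((y - m) / s)) => a b *.
by rewrite ler_norml; apply/andP; split; lra.
Qed.

Definition Phi x : R := ncdf 0 1 x.

Lemma is_derive_Phi (x : R) : is_derive x 1 Phi (stdpdf x).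
Proof. exact: is_derive_ncdf (oner_neq0 _). Qed.

(** The derivative of Phi x + Phi (- x) vanishes, and this sum tends to 1 at
    +oo. *)
Lemma PhiN x : Phi (- x) = 1 - Phi x.
Proof.
apply/eqP; rewrite eq_sym subr_eq; apply/eqP; rewrite addrC.
pose f x := Phi x + Phi (- x).
have fd (t : R) : is_derive t 1 f (0 : R).
  have d1 := is_derive_Phi t.
  have d2 := is_derive_Phi (- t).
  have d3 : is_derive t 1 (fun t => - t) (-1).
    by apply: is_derive_eq.
  have d4 : is_derive t 1 (Phi \o -%R) (stdpdf (- t) * -1).
    exact: is_derive1_comp.
  have d5 := is_deriveD d1 d4.
  apply: is_derive_eq.
  by rewrite stdpdfN; rewrite /GRing.scale /=; ring.
have fx := derive0_cst fd x.
apply/eqP; rewrite -subr_eq0 -normr_le0; apply/ler_addgt0Pl => e e0; rewrite addr0.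
have /cvgrPdist_lt /(_ e e0) [M [_ MP]] := @ncdf_cvgy 0 1.
have [y2 h2] := ncdf_lt_eps 0 1 e0.
rewrite -/(f x) (fx (Num.max (- y2) (M + 1))) /f.
set y := Num.max _ _.
have hy : M < y by rewrite lt_max ltrDl ltr01 orbT.
have hy2 : Phi (- y) < e.
  by apply: h2; rewrite lerNl le_max lexx.
have := MP y hy; rewrite /= -/(Phi y).
have := ncdf_ge0 0 1 (- y); rewrite -/(Phi _).
have := ncdf_le1 0 1 y; rewrite -/(Phi _).
rewrite ltr_norml ler_norml => ? ?; lra.
Qed.

End NormalCdf.

(** * Stein's equation for indicators of half-lines *)

Section SteinSolution.
Variable R : realType.
Implicit Types (w x y z c : R).

Lemma le_Phi x y : x <= y -> Phi x <= Phi y.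
Proof.
move=> xy; apply: (derive_ge0_homo (fun t _ => is_derive_Phi t) _ xy) => // t _.
exact: ltW (stdpdf_gt0 _).
Qed.

Lemma Phi_ge0 x : 0 <= Phi x. Proof. exact: ncdf_ge0. Qed.
Lemma Phi_le1 x : Phi x <= 1. Proof. exact: ncdf_le1. Qed.

(** The function s below is nondecreasing on the negative half-line, its
    derivative being stdpdf t / t ^ 2, and it is at least - Phi, which tends to
    0 at -oo. *)
Lemma Phi_tail w : w < 0 -> - w * Phi w <= stdpdf w.
Proof.
move=> w0.
pose s w := stdpdf w / (- w) - Phi w.
have sd t : t <= w -> is_derive t 1 s (stdpdf t / t ^+ 2).
  move=> tw; have tn0 : - t != 0 by rewrite oppr_eq0 lt_eqF// (le_lt_trans tw).
  have d1 := is_derive_stdpdf t.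
  have d2 := is_derive_Phi t.
  have d3 : is_derive t 1 (fun t => (- t)^-1) (- (- t) ^- 2 *: -1).
    have dN : is_derive t 1 (-%R) (-1 : R) by apply: is_derive_eq.
    exact: is_deriveV.
  have d4 := is_deriveB (is_deriveM d1 d3) d2.
  apply: is_derive_eq; rewrite /GRing.scale /=; field.
  by rewrite -oppr_eq0.
suff : 0 <= s w.
  rewrite /s subr_ge0 ler_pdivlMr ?oppr_gt0//; lra.
apply/ler_addgt0Pl => e e0; rewrite -lerBlDl sub0r.
have [M hM] := ncdf_lt_eps 0 1 e0.
pose t := Num.min w M.
have tw : t <= w by rewrite ge_min lexx.
apply: (@le_trans _ _ (s t)); last first.
  apply: (derive_ge0_homo sd) => // u uw.
  by rewrite divr_ge0 ?sqr_ge0// ltW// stdpdf_gt0.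
have : Phi t < e by apply: hM; rewrite ge_min lexx orbT.
have : 0 <= stdpdf t / - t.
  by rewrite divr_ge0 ?(ltW (stdpdf_gt0 _))// oppr_ge0 (le_trans tw) ?ltW.
rewrite /s; lra.
Qed.

Definition mills w : R := Phi w / stdpdf w.

(** For w <= -1 the ratio is at most 1 by the tail estimate; between -1 and 0
    the numerator is at most 1 and the density is at least its value at 1. *)
Definition mills_bound : R := 1 + (stdpdf (1 : R))^-1.

Lemma mills_ge0 w : 0 <= mills w.
Proof. by rewrite divr_ge0 ?Phi_ge0 ?(ltW (stdpdf_gt0 _)). Qed.

Lemma mills_tail w : w <= 0 -> - w * mills w <= 1.
Proof.
rewrite le_eqVlt => /predU1P[->|w0]; first by rewrite oppr0 mul0r ler01.
by rewrite /mills mulrA ler_pdivrMr ?stdpdf_gt0// mul1r Phi_tail.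
Qed.

Lemma mills_le w : w <= 0 -> mills w <= mills_bound.
Proof.
move=> w0; have h := mills_tail w0; have m0 := mills_ge0 w.
have p1 : 0 < (stdpdf (1 : R))^-1 by rewrite invr_gt0 stdpdf_gt0.
case: (lerP w (-1)) => w1.
  apply: (@le_trans _ _ 1); last by rewrite lerDl ltW.
  by apply: le_trans h; rewrite ler_peMl//; lra.
apply: (@le_trans _ _ (stdpdf (1 : R))^-1); last by rewrite lerDr.
rewrite /mills ler_pdivrMr ?stdpdf_gt0//; apply: le_trans (Phi_le1 w) _.
rewrite ler_pdivlMl ?stdpdf_gt0// mulr1 !stdpdfE.
rewrite ler_wpM2l ?normal_peak_ge0// ler_expR lerN2 ler_pM2r ?invr_gt0//.
by nra.
Qed.

Lemma is_derive_mills (w : R) : is_derive w 1 mills (1 + w * mills w).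
Proof.
have p0 := lt0r_neq0 (stdpdf_gt0 w).
have d1 := is_derive_stdpdf w.
have d2 := is_derive_Phi w.
have d3 := is_deriveV p0 d1.
have d4 := is_deriveM d2 d3.
apply: is_derive_eq; rewrite /GRing.scale /mills /=; field.
exact: p0.
Qed.

(** On w <= z the bounded solution of f'(w) - w f(w) = (w <= z) - Phi z is a
    multiple of the Mills ratio; the other half-line is obtained by reflection,
    so that every estimate is only needed for this branch. *)
Definition steinL z w : R := Phi (- z) * mills w.
Definition dsteinL z w : R := Phi (- z) + w * steinL z w.

Lemma is_derive_steinL z (w : R) : is_derive w 1 (steinL z) (dsteinL z w).
Proof.
have d1 := is_derive_mills w.
have d2 := is_deriveZ (Phi (- z)) d1.
rewrite (_ : dsteinL z w = Phi (- z) *: (1 + w * mills w)); first exact: d2.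
by rewrite /GRing.scale /dsteinL /steinL /=; ring.
Qed.

Lemma is_derive_wsteinL z (w : R) :
  is_derive w 1 (fun w => w * steinL z w) (steinL z w + w * dsteinL z w).
Proof.
have d1 := is_derive_steinL z w.
have d2 := is_deriveM (is_derive_id w 1) d1.
by apply: is_derive_eq; rewrite /GRing.scale /=; ring.
Qed.

Lemma steinL_ge0 z w : 0 <= steinL z w.
Proof. by rewrite mulr_ge0 ?Phi_ge0 ?mills_ge0. Qed.

(** The Mills ratio is unbounded on the right, but up to z its growth is
    compensated by the factor Phi (- z) <= Phi (- w). *)
Lemma steinL_sym z w : 0 <= w -> w <= z -> steinL z w <= mills (- w).
Proof.
move=> w0 wz; rewrite /steinL /mills stdpdfN mulrA.
rewrite ler_pM2r ?invr_gt0 ?stdpdf_gt0//.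
rewrite -[leRHS]mulr1 ler_pM ?Phi_ge0 ?Phi_le1// le_Phi//.
by rewrite lerN2.
Qed.

Lemma steinL_le_mills z w : steinL z w <= mills w.
Proof. by rewrite /steinL ler_piMl ?mills_ge0 ?Phi_le1. Qed.

Lemma steinL_le z w : w <= z -> steinL z w <= mills_bound.
Proof.
move=> wz; case: (lerP w 0) => w0.
  exact: le_trans (steinL_le_mills _ _) (mills_le _).
by apply: le_trans (steinL_sym (ltW w0) wz) (mills_le _); rewrite oppr_le0 ltW.
Qed.

Lemma wsteinL_le z w : w <= z -> `|w * steinL z w| <= 1.
Proof.
move=> wz; rewrite normrM (ger0_norm (steinL_ge0 _ _)).
case: (lerP w 0) => w0.
  rewrite ler0_norm//; apply: le_trans (mills_tail w0).
  by rewrite ler_wpM2l ?oppr_ge0 ?steinL_le_mills.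
rewrite gtr0_norm//; apply: (@le_trans _ _ (w * mills (- w))).
  by rewrite ler_wpM2l ?(ltW w0)// steinL_sym ?(ltW w0).
by rewrite -{1}[w]opprK mills_tail// oppr_le0 ltW.
Qed.

Lemma dsteinL_le z w : w <= z -> `|dsteinL z w| <= 2.
Proof.
move=> wz; have := wsteinL_le wz; have := Phi_ge0 (- z); have := Phi_le1 (- z).
by rewrite /dsteinL !ler_norml => ? ? /andP[? ?]; apply/andP; split; lra.
Qed.

Lemma between_le x y c :
  Num.min x y <= c -> c <= Num.max x y -> `|c - x| <= `|y - x|.
Proof.
case: (leP x y) => xy h1 h2; first by rewrite !ger0_norm; lra.
by rewrite !ler0_norm; lra.
Qed.

Lemma steinL_lip z x y : x <= z -> y <= z ->
  `|steinL z y - steinL z x| <= 2 * `|y - x|.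
Proof.
move=> xz yz.
have [c [_ cM ->]] := mvt_below (fun t _ => is_derive_steinL z t) xz yz.
rewrite normrM ler_wpM2r// dsteinL_le//; apply: le_trans cM _.
by rewrite ge_max xz.
Qed.

(** The derivative dsteinL differs by a constant from w * steinL z w, whose
    own derivative grows at most linearly; the mean value theorem is applied to
    both. *)
Lemma steinL_taylor z x y : x <= z -> y <= z ->
  `|steinL z y - steinL z x - dsteinL z x * (y - x)| <=
    (mills_bound + 2 * `|x| + 2 * `|y - x|) * `|y - x| ^+ 2.
Proof.
move=> xz yz.
have [c [mc cM ->]] := mvt_below (fun t _ => is_derive_steinL z t) xz yz.
have cz : c <= z by rewrite (le_trans cM)// ge_max xz.
have cx := between_le mc cM.
have [u [mu uM e]] := mvt_below (fun t _ => is_derive_wsteinL z t) xz cz.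
have uz : u <= z by rewrite (le_trans uM)// ge_max xz.
have ux := le_trans (between_le mu uM) cx.
have -> : dsteinL z c * (y - x) - dsteinL z x * (y - x) =
    (c * steinL z c - x * steinL z x) * (y - x) by rewrite /dsteinL; ring.
rewrite e !normrM expr2 mulrA ler_wpM2r// ler_pM//.
have h1 := steinL_le uz; have h2 := steinL_ge0 z u.
have h3 : `|u * dsteinL z u| <= 2 * `|u|.
  by rewrite normrM mulrC ler_wpM2r// dsteinL_le.
have h4 : `|u| <= `|x| + `|y - x|.
  by rewrite -[u](subrK x) addrC (le_trans (ler_normD _ _))// lerD2l.
apply: le_trans (ler_normD _ _) _; rewrite (ger0_norm h2); lra.
Qed.

Definition stein z w : R := if w <= z then steinL z w else steinL (- z) (- w).
(** At the kink w = z this is the left derivative. *)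
Definition dstein z w : R :=
  if w <= z then dsteinL z w else - dsteinL (- z) (- w).

Lemma stein_eq z w : dstein z w - w * stein z w = (w <= z)%R%:R - Phi z.
Proof.
rewrite /dstein /stein; case: ifP => _ /=; rewrite /dsteinL ?opprK ?PhiN; ring.
Qed.

Lemma stein_norm_le z w : `|stein z w| <= mills_bound.
Proof.
rewrite /stein; case: (lerP w z) => h; rewrite ger0_norm ?steinL_ge0// steinL_le//.
by rewrite lerN2 ltW.
Qed.

Lemma dstein_le z w : `|dstein z w| <= 2.
Proof.
rewrite /dstein; case: (lerP w z) => h; rewrite ?normrN dsteinL_le//.
by rewrite lerN2 ltW.
Qed.

Lemma stein_lip z x y : `|stein z y - stein z x| <= 2 * `|y - x|.
Proof.
have eqz : steinL z z = steinL (- z) (- z).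
  by rewrite /steinL /mills stdpdfN opprK; ring.
have main a b : a <= z -> z < b ->
    `|steinL (- z) (- b) - steinL z a| <= 2 * `|b - a|.
  move=> az zb.
  have zb' : - b <= - z by rewrite lerN2 ltW.
  have h1 := steinL_lip zb' (lexx (- z)); have h2 := steinL_lip az (lexx z).
  have e1 : - z - - b = b - z by ring.
  rewrite -eqz e1 (ger0_norm (_ : 0 <= b - z)) ?subr_ge0 ?(ltW zb)// in h1.
  rewrite (ger0_norm (_ : 0 <= z - a)) ?subr_ge0// in h2.
  rewrite (ger0_norm (_ : 0 <= b - a)) ?subr_ge0 ?(ltW (le_lt_trans az zb))//.
  move: h1 h2; rewrite !ler_norml => /andP[? ?] /andP[? ?].
  by apply/andP; split; lra.
rewrite /stein; case: (lerP x z) => xz; case: (lerP y z) => yz.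
- exact: steinL_lip.
- exact: main.
- by rewrite distrC (distrC y) main.
- have -> : `|y - x| = `|- y - - x| by rewrite -opprD normrN.
  by rewrite steinL_lip// lerN2 ltW.
Qed.

(** If z lies within |x - y| of x, the Lipschitz bound is used; this is the
    term with the indicator, which [exchangeable_concentration] controls.
    Otherwise x and y lie on the same side of z, where the solution is smooth. *)
Lemma stein_taylor z x y :
  `|stein z x - stein z y - dstein z x * (x - y)| <=
    ((mills_bound + 2 * `|x| + 2 * `|x - y|) * `|x - y|
      + 4 * (`|x - z| <= `|x - y|)%R%:R) * `|x - y|.
Proof.
have mb0 : 0 <= mills_bound.
  by apply: le_trans (mills_ge0 0) (mills_le _).
have P0 : 0 <= (mills_bound + 2 * `|x| + 2 * `|x - y|) * `|x - y|.
  apply: mulr_ge0 => //.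
  by apply: addr_ge0; [apply: addr_ge0|]; rewrite ?mulr_ge0.
case: (lerP `|x - z| `|x - y|) => h /=.
  rewrite mulr1; apply: (@le_trans _ _ (4 * `|x - y|)); last first.
    by rewrite ler_wpM2r// lerDr.
  apply: le_trans (ler_normB _ _) _; rewrite normrM.
  have : `|dstein z x| * `|x - y| <= 2 * `|x - y|.
    by rewrite ler_wpM2r// dstein_le.
  have := stein_lip z y x; lra.
rewrite mulr0 addr0 -mulrA -expr2.
rewrite /stein /dstein; case: (lerP x z) => xz.
  have yz : y <= z.
    rewrite leNgt; apply/negP => yz; move: h.
    by rewrite ltNge => /negP; apply; rewrite !ler0_norm ?subr_le0//; lra.
  rewrite yz; have := steinL_taylor xz yz; rewrite (distrC y x) => h'.
  apply: le_trans _ h'; rewrite -[leRHS]normrN le_eqVlt; apply/orP; left.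
  by apply/eqP; congr `|_|; ring.
have yz : z < y.
  rewrite ltNge; apply/negP => yz; move: h.
  by rewrite ltNge => /negP; apply; rewrite !ger0_norm ?subr_ge0//; lra.
have -> : (y <= z) = false by apply/negbTE; rewrite -ltNge.
have xz' : - x <= - z by rewrite lerN2 ltW.
have yz' : - y <= - z by rewrite lerN2 ltW.
have := steinL_taylor xz' yz'; rewrite normrN.
have -> : - y - - x = x - y by ring.
move=> h'; apply: le_trans _ h'; rewrite -[leRHS]normrN le_eqVlt; apply/orP; left.
by apply/eqP; congr `|_|; ring.
Qed.

End SteinSolution.

(** * Averages over finite types *)

Section Mean.
Variables (R : realType) (T : finType).
Implicit Types (F G : T -> R) (c : R).

Definition mean F : R := (\sum_t F t) / #|T|%:R.

Lemma eq_mean F G : F =1 G -> mean F = mean G.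
Proof. by move=> FG; rewrite /mean (eq_bigr G). Qed.

Lemma meanD F G : mean (fun t => F t + G t) = mean F + mean G.
Proof. by rewrite /mean big_split mulrDl. Qed.

Lemma meanZ c F : mean (fun t => c * F t) = c * mean F.
Proof. by rewrite /mean -mulr_sumr mulrA. Qed.

Lemma meanN F : mean (fun t => - F t) = - mean F.
Proof. by rewrite /mean sumrN mulNr. Qed.

Lemma meanB F G : mean (fun t => F t - G t) = mean F - mean G.
Proof. by rewrite meanD meanN. Qed.

Lemma mean_sum (I : Type) (r : seq I) (P : pred I) (F : I -> T -> R) :
  mean (fun t => \sum_(i <- r | P i) F i t) = \sum_(i <- r | P i) mean (F i).
Proof. by rewrite /mean exchange_big mulr_suml. Qed.

Lemma ler_mean F G : (forall t, F t <= G t) -> mean F <= mean G.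
Proof. by move=> FG; rewrite ler_wpM2r ?invr_ge0// ler_sum. Qed.

Lemma mean_ge0 F : (forall t, 0 <= F t) -> 0 <= mean F.
Proof. by move=> F0; rewrite mulr_ge0 ?invr_ge0// sumr_ge0. Qed.

Lemma ler_norm_mean F : `|mean F| <= mean (fun t => `|F t|).
Proof.
by rewrite normrM [X in _ * X]ger0_norm ?invr_ge0// ler_wpM2r ?invr_ge0// ler_norm_sum.
Qed.

Lemma mean_reindex (h : T -> T) F : involutive h -> mean (F \o h) = mean F.
Proof.
by move=> hK; rewrite /mean [in RHS](reindex h)//; exists h => x _; exact: hK.
Qed.

Lemma mean_cst c : (0 < #|T|)%N -> mean (fun=> c) = c.
Proof.
move=> T0; rewrite /mean sumr_const -[X in X / _]mulr_natr mulfK//.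
by rewrite pnatr_eq0 -lt0n.
Qed.

Lemma mean_cauchy_schwarz F G :
  mean (fun t => F t * G t) ^+ 2 <= mean (fun t => F t ^+ 2) * mean (fun t => G t ^+ 2).
Proof.
set a := mean (fun t => F t ^+ 2); set b := mean (fun t => G t ^+ 2).
set c := mean _.
have a0 : 0 <= a by apply: mean_ge0 => t; exact: sqr_ge0.
have b0 : 0 <= b by apply: mean_ge0 => t; exact: sqr_ge0.
have P x : 0 <= a - 2 * x * c + x ^+ 2 * b.
  have -> : a - 2 * x * c + x ^+ 2 * b = mean (fun t => (F t - x * G t) ^+ 2).
    rewrite -!meanZ -meanB -meanD; apply: eq_mean => t; ring.
  by apply: mean_ge0 => t; exact: sqr_ge0.
have [b00|bn0] := eqVneq b 0.
  have [->|cn0] := eqVneq c 0; first by rewrite expr0n mulr_ge0.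
  (* For b = 0 the nonnegative P is affine, but takes the value -1 here. *)
  have := P ((a + 1) / (2 * c)); rewrite b00 mulr0 addr0.
  have -> : 2 * ((a + 1) / (2 * c)) * c = a + 1 by field.
  by rewrite opprD addrA subrr sub0r ler0N1.
have := P (c / b).
have -> : a - 2 * (c / b) * c + (c / b) ^+ 2 * b = a - c ^+ 2 / b by field.
by rewrite subr_ge0 ler_pdivrMr// lt_neqAle eq_sym bn0.
Qed.

Lemma mean_abs_le F c : (0 < #|T|)%N -> 0 <= c ->
  mean (fun t => F t ^+ 2) <= c ^+ 2 -> mean (fun t => `|F t|) <= c.
Proof.
move=> T0 c0 h; rewrite -(ler_pXn2r (_ : (0 < 2)%N)) ?nnegrE ?mean_ge0//.
apply: le_trans h; have := mean_cauchy_schwarz (fun t => `|F t|) (fun=> 1).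
rewrite (eq_mean (_ : _ =1 (fun t => `|F t|))) => [|t]; last by rewrite mulr1.
rewrite [X in _ * X](eq_mean (_ : _ =1 (fun=> 1))) => [|t]; last by rewrite expr1n.
rewrite mean_cst// mulr1 => /le_trans; apply.
by apply: ler_mean => t; rewrite real_normK ?num_real.
Qed.

End Mean.

Section MeanMore.
Variable R : realType.

Lemma mean_pair (A B : finType) (f : A * B -> R) :
  mean f = mean (fun a => mean (fun b => f (a, b))).
Proof.
rewrite /mean -mulr_suml pair_bigA /= card_prod natrM invfM.
rewrite [in RHS]mulrAC -mulrA; congr (_ * _).
by apply: eq_bigr => -[].
Qed.

Lemma mean_swap (A B : finType) (f : A -> B -> R) :
  mean (fun a => mean (f a)) = mean (fun b => mean (fun a => f a b)).
Proof.
by rewrite /mean -!mulr_suml exchange_big /= mulrAC.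
Qed.

Lemma mean_holder (T : finType) (F G : T -> R) (f g : R) : 0 <= f -> 0 <= g ->
  mean (fun t => F t ^+ 2) <= f ^+ 2 -> mean (fun t => G t ^+ 2) <= g ^+ 2 ->
  `|mean (fun t => F t * G t)| <= f * g.
Proof.
move=> f0 g0 hF hG; rewrite -(ler_pXn2r (_ : (0 < 2)%N)) ?nnegrE ?mulr_ge0//.
rewrite real_normK ?num_real// [leRHS]exprMn; apply: le_trans (mean_cauchy_schwarz F G) _.
by apply: ler_pM => //; apply: mean_ge0 => t; exact: sqr_ge0.
Qed.

Lemma mean_sqrD (T : finType) (F G : T -> R) (f g : R) : 0 <= f -> 0 <= g ->
  mean (fun t => F t ^+ 2) <= f ^+ 2 -> mean (fun t => G t ^+ 2) <= g ^+ 2 ->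
  mean (fun t => (F t + G t) ^+ 2) <= (f + g) ^+ 2.
Proof.
move=> f0 g0 hF hG.
have -> : mean (fun t => (F t + G t) ^+ 2) =
    mean (fun t => F t ^+ 2) + 2 * mean (fun t => F t * G t) + mean (fun t => G t ^+ 2).
  by rewrite -meanZ -!meanD; apply: eq_mean => t; ring.
have := mean_holder f0 g0 hF hG; rewrite ler_norml => /andP[_ h].
by rewrite sqrrD -[f * g *+ 2]mulr_natl; lra.
Qed.

End MeanMore.

(** * Stein's method for exchangeable pairs *)

Section Clip.
Variable R : realType.
Implicit Types (x y z d : R).

Definition clip d z x : R := Num.max (- d) (Num.min d (x - z)).

Lemma clip_norm_le d z x : 0 <= d -> `|clip d z x| <= d.
Proof.
move=> d0; rewrite /clip ler_norml le_max lexx ge_max ge_min lexx /= andbT.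
by rewrite ge0_cp.
Qed.

Lemma clip_mono d z x y : (x - y) * (clip d z x - clip d z y) >= 0.
Proof.
have main a b : a <= b -> clip d z a <= clip d z b.
  move=> ab; rewrite /clip le_max2//= le_min2// lerB//.
case: (lerP x y) => xy; first by rewrite mulr_le0// subr_le0// main.
by rewrite mulr_ge0// subr_ge0 ?main// ltW.
Qed.

Lemma clip_id d z x : `|x - z| <= d -> clip d z x = x - z.
Proof.
rewrite ler_norml /clip => /andP[h1 h2].
by rewrite min_r// max_r.
Qed.

End Clip.

(** Conditional expectations given W are expressed by testing against
    functions of W: [regression] says that the drift of W is - lam * (W + rho),
    and [conditional_square] that F is the conditional mean of
    (W - W') ^ 2 / (2 * lam), up to functions orthogonal to those of W. *)
Section ExchangeablePair.
Variables (R : realType) (S : finType) (tau : S -> S) (W rho F : S -> R).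
Variables (lam del : R).
Hypothesis S0 : (0 < #|S|)%N.
Hypothesis tauK : involutive tau.
Hypothesis lam0 : 0 < lam.
Hypothesis step : forall s, `|W s - W (tau s)| <= del.
Hypothesis regression : forall f : R -> R,
  mean (fun s => (W s - W (tau s)) * f (W s)) =
  lam * mean (fun s => (W s + rho s) * f (W s)).
Hypothesis conditional_square : forall f : R -> R,
  mean (fun s => (W s - W (tau s)) ^+ 2 * f (W s)) =
  2 * lam * mean (fun s => F s * f (W s)).

Let D s := W s - W (tau s).
Let EW := mean (fun s => `|W s|).
Let Erho := mean (fun s => `|rho s|).

Let del0 : 0 <= del.
Proof. by case/card_gt0P: S0 => s _; exact: le_trans (step s). Qed.

(** Exchanging W and W' = W o tau shows that the two halves of the left-hand
    side are equal. *)
Lemma exchangeable_mean f :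
  mean (fun s => D s * (f (W s) - f (W (tau s)))) =
  2 * lam * mean (fun s => (W s + rho s) * f (W s)).
Proof.
rewrite -mulrA -regression.
have -> : mean (fun s => D s * (f (W s) - f (W (tau s)))) =
    mean (fun s => D s * f (W s)) + mean ((fun s => D s * f (W s)) \o tau).
  rewrite -meanD; apply: eq_mean => s /=; rewrite /D tauK; ring.
by rewrite mean_reindex// mulrDl mul1r.
Qed.

(** The test function is the identity clipped at distance 2 * del from z.  It
    is monotone, so the summands (W - W') * (f W - f W') are nonnegative, and
    equal to (W - W') ^ 2 when W is within del of z; on the other hand f is
    bounded by 2 * del. *)
Lemma exchangeable_concentration z :
  mean (fun s => (`|W s - z| <= del)%R%:R * D s ^+ 2) <=
  2 * lam * (2 * del * (EW + Erho)).
Proof.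
have d20 : 0 <= 2 * del by rewrite mulr_ge0.
apply: (@le_trans _ _ (mean (fun s =>
    D s * (clip (2 * del) z (W s) - clip (2 * del) z (W (tau s)))))).
  apply: ler_mean => s; case: (lerP `|W s - z| del) => h /=; last first.
    by rewrite mul0r clip_mono.
  have h' := step s.
  rewrite mul1r !clip_id.
  - by rewrite /D le_eqVlt; apply/orP; left; apply/eqP; ring.
  - by move: h h'; rewrite !ler_norml => /andP[? ?] /andP[? ?]; apply/andP; split; lra.
  - by apply: le_trans h _; lra.
rewrite exchangeable_mean ler_wpM2l ?mulr_ge0 ?(ltW lam0)//.
rewrite mulrDr -!meanZ -meanD; apply: ler_mean => s.
apply: le_trans (ler_norm _) _; rewrite normrM -mulrDr mulrC ler_pM//.
- exact: clip_norm_le.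
- exact: ler_normD.
Qed.

(** Insert W in Stein's equation.  The term W f(W) is rewritten by
    [exchangeable_mean] and expanded to first order: the main part leaves
    (1 - F) f'(W), the regression error leaves rho f(W), and the Taylor
    remainder is of order del ^ 3 / lam away from z, and is bounded by the
    concentration inequality near z. *)
Lemma stein_exchangeable z :
  `|mean (fun s => (W s <= z)%R%:R) - Phi z| <=
  2 * mean (fun s => `|1 - F s|) + mills_bound R * Erho
  + del ^+ 3 / (2 * lam) * (mills_bound R + 2 * EW + 2 * del)
  + 8 * del * (EW + Erho).
Proof.
pose f := stein z; pose g := dstein z.
pose T s := D s * (g (W s) * D s - (f (W s) - f (W (tau s)))).
have l2 : 0 < 2 * lam by rewrite mulr_gt0.
have eq1 : mean (fun s => (W s <= z)%R%:R) - Phi z =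
    mean (fun s => (1 - F s) * g (W s)) + (2 * lam)^-1 * mean T
    + mean (fun s => rho s * f (W s)).
  have -> : mean T = 2 * lam * mean (fun s => F s * g (W s)) -
      2 * lam * mean (fun s => (W s + rho s) * f (W s)).
    rewrite -exchangeable_mean -conditional_square -meanB.
    by apply: eq_mean => s; rewrite /T /D; ring.
  rewrite -mulrBr mulKf ?gt_eqF// -{1}[Phi z](mean_cst (Phi z) S0) -!meanB -!meanD.
  apply: eq_mean => s; rewrite -stein_eq; rewrite /f /g; ring.
rewrite eq1.
apply: le_trans (ler_normD _ _) _; apply: le_trans (lerD (ler_normD _ _) (lexx _)) _.
have b1 : `|mean (fun s => (1 - F s) * g (W s))| <= 2 * mean (fun s => `|1 - F s|).
  apply: le_trans (ler_norm_mean _) _; rewrite -meanZ; apply: ler_mean => s.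
  by rewrite normrM mulrC ler_wpM2r// dstein_le.
have b2 : `|mean (fun s => rho s * f (W s))| <= mills_bound R * Erho.
  apply: le_trans (ler_norm_mean _) _; rewrite -meanZ; apply: ler_mean => s.
  by rewrite normrM mulrC ler_wpM2r// stein_norm_le.
have b3 : `|mean T| <= del ^+ 3 * (mills_bound R + 2 * EW + 2 * del) +
    4 * mean (fun s => (`|W s - z| <= del)%R%:R * D s ^+ 2).
  apply: le_trans (ler_norm_mean _) _.
  have -> : del ^+ 3 * (mills_bound R + 2 * EW + 2 * del) +
      4 * mean (fun s => (`|W s - z| <= del)%R%:R * D s ^+ 2) =
    mean (fun s => del ^+ 3 * (mills_bound R + 2 * `|W s| + 2 * del) +
      4 * ((`|W s - z| <= del)%R%:R * D s ^+ 2)).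
    by rewrite meanD !meanZ !meanD !meanZ !mean_cst.
  apply: ler_mean => s.
  rewrite /T normrM.
  have ht := stein_taylor z (W s) (W (tau s)).
  have hs := step s; rewrite -/(D s) in ht hs.
  have -> : `|g (W s) * D s - (f (W s) - f (W (tau s)))| =
     `|stein z (W s) - stein z (W (tau s)) - dstein z (W s) * D s|.
    by rewrite -normrN; congr `|_|; rewrite /f /g; ring.
  apply: le_trans (ler_wpM2l (normr_ge0 _) ht) _.
  have N0 := normr_ge0 (D s); have W0 := normr_ge0 (W s).
  have mb0 : 0 <= mills_bound R.
    by apply: le_trans (mills_ge0 0) (mills_le _).
  have -> : D s ^+ 2 = `|D s| ^+ 2 by rewrite real_normK ?num_real.
  have e0 : ((`|W s - z| <= `|D s|)%R%:R : R) <= (`|W s - z| <= del)%R%:R.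
    rewrite ler_nat; case: (lerP _ `|D s|) => // h.
    by rewrite (le_trans h).
  set e := (`|W s - z| <= `|D s|)%R%:R in e0 *.
  set e' := (`|W s - z| <= del)%R%:R in e0 *.
  set x := `|D s| in hs N0 *; set w := `|W s| in W0 *; set b := mills_bound R in mb0 *.
  have -> : x * (((b + 2 * w + 2 * x) * x + 4 * e) * x) =
     x ^+ 3 * (b + 2 * w + 2 * x) + 4 * (e * x ^+ 2) by ring.
  apply: lerD.
    by rewrite ler_pM ?exprn_ge0//; [lra | rewrite ler_pXn2r|lra].
  by rewrite ler_pM2l// ler_wpM2r// exprn_ge0.
have b4 : `|(2 * lam)^-1 * mean T| <=
    del ^+ 3 / (2 * lam) * (mills_bound R + 2 * EW + 2 * del) + 8 * del * (EW + Erho).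
  rewrite normrM gtr0_norm ?invr_gt0//.
  rewrite ler_pdivrMl//; apply: le_trans b3 _.
  have h := exchangeable_concentration z.
  have -> : 2 * lam * (del ^+ 3 / (2 * lam) * (mills_bound R + 2 * EW + 2 * del)
     + 8 * del * (EW + Erho)) = del ^+ 3 * (mills_bound R + 2 * EW + 2 * del)
     + 4 * (2 * lam * (2 * del * (EW + Erho))).
    by field; rewrite gt_eqF.
  by rewrite lerD2l ler_pM2l.
lra.
Qed.

End ExchangeablePair.

(** * Resampling the coordinates of a product space *)

Section Product.
Variables (R : realType) (V I : finType).
Hypothesis I0 : (0 < #|I|)%N.
Local Notation Om := {ffun V -> I}.
Implicit Types (u : Om) (i j : V) (v w : I) (F G : Om -> R) (c : R).

Definition upd u i v : Om := [ffun k => if k == i then v else u k].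

Lemma upd_same u i v : upd u i v i = v.
Proof. by rewrite ffunE eqxx. Qed.

Lemma upd_other u i v k : k != i -> upd u i v k = u k.
Proof. by rewrite ffunE => /negbTE ->. Qed.

Lemma upd_upd u i v w : upd (upd u i v) i w = upd u i w.
Proof. by apply/ffunP => k; rewrite !ffunE; case: eqP. Qed.

Lemma upd_id u i : upd u i (u i) = u.
Proof. by apply/ffunP => k; rewrite !ffunE; case: eqP => [->|]. Qed.

Lemma upd_comm u i j v w : i != j -> upd (upd u i v) j w = upd (upd u j w) i v.
Proof.
move=> ij; apply/ffunP => k; rewrite !ffunE.
by case: (eqVneq k j) => [->|//]; rewrite eq_sym (negbTE ij).
Qed.

Lemma Om_card0 : (0 < #|{: Om}|)%N.
Proof. by rewrite card_ffun expn_gt0 I0. Qed.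

Definition avg i F u : R := mean (fun v => F (upd u i v)).

Definition indep i F := forall u v, F (upd u i v) = F u.

Lemma avg_indep i F : indep i F -> avg i F =1 F.
Proof.
by move=> iF u; rewrite /avg (eq_mean (iF u)) mean_cst.
Qed.

Lemma indep_avg i F : indep i (avg i F).
Proof. by move=> u v; apply: eq_mean => w; rewrite upd_upd. Qed.

Lemma indep_avg_other i j F : indep i F -> indep i (avg j F).
Proof.
move=> iF u v; apply: eq_mean => w; have [->|ij] := eqVneq i j.
  by rewrite upd_upd.
by rewrite upd_comm.
Qed.

Lemma avg_mulr i F G u : indep i F ->
  avg i (fun u => F u * G u) u = F u * avg i G u.
Proof. by move=> iF; rewrite /avg -meanZ; apply: eq_mean => v; rewrite iF. Qed.

Lemma avgD i F G u : avg i (fun u => F u + G u) u = avg i F u + avg i G u.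
Proof. exact: meanD. Qed.

Lemma avgB i F G u : avg i (fun u => F u - G u) u = avg i F u - avg i G u.
Proof. exact: meanB. Qed.

Lemma avgZ i c F u : avg i (fun u => c * F u) u = c * avg i F u.
Proof. exact: meanZ. Qed.

Lemma avg_sum (J : Type) (r : seq J) (P : pred J) (F : J -> Om -> R) i u :
  avg i (fun u => \sum_(k <- r | P k) F k u) u = \sum_(k <- r | P k) avg i (F k) u.
Proof. exact: mean_sum. Qed.

Lemma eq_avg i F G : F =1 G -> avg i F =1 avg i G.
Proof. by move=> FG u; apply: eq_mean => v. Qed.

Lemma avg_comm i j F : avg i (avg j F) =1 avg j (avg i F).
Proof.
move=> u; have [->//|ij] := eqVneq i j.
rewrite /avg mean_swap; apply: eq_mean => w; apply: eq_mean => v.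
by rewrite upd_comm.
Qed.

(** The map (u, v) |-> (upd u i v, u i) is an involution. *)
Lemma mean_avg i F : mean (avg i F) = mean F.
Proof.
pose h (p : Om * I) := (upd p.1 i p.2, p.1 i).
have hK : involutive h by case=> u v; rewrite /h /= upd_upd upd_same upd_id.
rewrite /avg -(mean_pair (fun p : Om * I => F (upd p.1 i p.2))).
rewrite -[LHS](mean_reindex (h := h)) // mean_pair.
rewrite /comp /h /=; apply: eq_mean => u.
rewrite (eq_mean (G := fun=> F u)) ?mean_cst// => v.
by rewrite /= upd_upd upd_id.
Qed.

Lemma mean_orthogonal i j F G : indep i F -> indep j F ->
  avg i (avg j G) =1 (fun=> 0) -> mean (fun u => F u * G u) = 0.
Proof.
move=> iF jF G0; rewrite -(mean_avg j) -(mean_avg i).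
rewrite (eq_mean (G := fun=> 0)) ?mean_cst ?Om_card0// => u.
rewrite (@eq_avg i _ (fun u => F u * avg j G u)) => [|w]; last exact: avg_mulr.
by rewrite avg_mulr// G0 mulr0.
Qed.

Lemma mean_orthogonal1 i F G : indep i F ->
  avg i G =1 (fun=> 0) -> mean (fun u => F u * G u) = 0.
Proof.
move=> iF G0; apply: (@mean_orthogonal i i) => // u.
by rewrite avg_indep//; exact: indep_avg.
Qed.

(** [avg i] is the orthogonal projection on the functions that do not depend
    on coordinate i. *)
Lemma mean_avg_pythagoras i F :
  mean (fun u => F u ^+ 2) =
  mean (fun u => avg i F u ^+ 2) + mean (fun u => (F u - avg i F u) ^+ 2).
Proof.
have h : mean (fun u => avg i F u * (F u - avg i F u)) = 0.
  apply: (@mean_orthogonal1 i); first exact: indep_avg.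
  by move=> u; rewrite avgB (avg_indep (@indep_avg i F)) subrr.
rewrite (eq_mean (G := fun u => avg i F u ^+ 2 + (F u - avg i F u) ^+ 2 +
  2 * (avg i F u * (F u - avg i F u)))) => [|u]; last by ring.
by rewrite meanD meanD meanZ h mulr0 addr0.
Qed.

Definition bounded_diff c F := forall u i v, `|F u - F (upd u i v)| <= c.

Lemma bounded_diff_avg c i F : bounded_diff c F -> bounded_diff c (avg i F).
Proof.
move=> bF u j w; have [->|ji] := eqVneq j i.
  rewrite indep_avg subrr normr0.
  by case/card_gt0P: I0 => v _; exact: le_trans (bF u i v).
rewrite /avg -meanB; apply: le_trans (ler_norm_mean _) _.
rewrite -[leRHS](mean_cst c I0); apply: ler_mean => v.
by rewrite upd_comm.
Qed.

Lemma sub_avg_le c i F u : bounded_diff c F -> `|F u - avg i F u| <= c.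
Proof.
move=> bF; rewrite /avg -{1}[F u](mean_cst (F u) I0) -meanB.
apply: le_trans (ler_norm_mean _) _.
by rewrite -[leRHS](mean_cst c I0); apply: ler_mean => v.
Qed.

Lemma iter_avg_sqr c (s : seq V) F : bounded_diff c F ->
  mean (fun u => F u ^+ 2) <=
  mean (fun u => foldr avg F s u ^+ 2) + (size s)%:R * c ^+ 2.
Proof.
move=> bF; elim: s => [|i s IH] /=; first by rewrite mul0r addr0.
have bs : bounded_diff c (foldr avg F s).
  by elim: s {IH} => //= j s; exact: bounded_diff_avg.
apply: le_trans IH _; rewrite (mean_avg_pythagoras i) -addrA lerD2l.
rewrite -natr1 mulrDl mul1r addrC lerD2l.
rewrite -[leRHS](mean_cst _ Om_card0); apply: ler_mean => u.
rewrite -real_normK ?num_real// ler_pXn2r ?nnegrE ?normr_ge0 ?sub_avg_le//.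
by apply: le_trans (sub_avg_le i u bs).
Qed.

Lemma indep_all_cst F : (forall i, indep i F) -> forall u u1, F u = F u1.
Proof.
move=> iF u w; pose t (s : seq V) : Om := foldr (fun i x => upd x i (w i)) u s.
have -> : w = t (enum V).
  apply/ffunP => k; have : k \in enum V by rewrite mem_enum.
  elim: (enum V) => //= i s IH; rewrite inE /t /= ffunE.
  by case: eqP => [->|_] //=; exact: IH.
by elim: (enum V) => //= i s ->; rewrite iF.
Qed.

Lemma mean_iter_avg s F : mean (foldr avg F s) = mean F.
Proof. by elim: s => //= i s IH; rewrite mean_avg. Qed.

Lemma iter_avg_cst F u : foldr avg F (enum V) u = mean F.
Proof.
rewrite -(mean_iter_avg (enum V)) -[LHS](mean_cst _ Om_card0).
apply: eq_mean => w; apply: indep_all_cst => i.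
have : i \in enum V by rewrite mem_enum.
elim: (enum V) => //= j s IH; rewrite inE => /predU1P[->|/IH].
  exact: indep_avg.
exact: indep_avg_other.
Qed.

(** Averaging out the coordinates one after the other ends at the mean, and by
    Pythagoras each step costs at most c ^ 2. *)
Lemma efron_stein c F : bounded_diff c F ->
  mean (fun u => (F u - mean F) ^+ 2) <= #|V|%:R * c ^+ 2.
Proof.
move=> bF; pose G u := F u - mean F.
have bG : bounded_diff c G.
  by move=> u i v; rewrite /G opprB addrA subrK.
apply: le_trans (iter_avg_sqr (enum V) bG) _.
rewrite -cardE (eq_mean (G := fun=> 0)) => [|u].
  by rewrite mean_cst ?Om_card0// add0r.
by rewrite iter_avg_cst /G meanB mean_cst ?Om_card0// subrr expr0n.
Qed.

(** Besides the configuration the state records the coordinate and the value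
    used for the resampling, so that a step and its reverse are exchanged by an
    involution. *)
Definition resample (s : Om * V * I) : Om * V * I :=
  (upd s.1.1 s.1.2 s.2, s.1.2, s.1.1 s.1.2).

Lemma resampleK : involutive resample.
Proof. by case=> -[u i] v; rewrite /resample /= upd_upd upd_same upd_id. Qed.

Lemma mean_resample (f : Om -> V -> I -> R) :
  mean (fun s : Om * V * I => f s.1.1 s.1.2 s.2) =
  mean (fun u => (\sum_i mean (f u i)) / #|V|%:R).
Proof. by rewrite mean_pair /= mean_pair. Qed.

Lemma mean_resample_fst F : (0 < #|V|)%N ->
  mean (fun s : Om * V * I => F s.1.1) = mean F.
Proof.
move=> V0; rewrite mean_pair /= mean_pair; apply: eq_mean => u /=.
by rewrite !mean_cst.
Qed.

End Product.

Arguments eq_avg {R V I i F G}.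

(** * Interlacing of uniform points on a discrete circle *)

Section ArcLength.
Variables (R : realType) (N : nat).
Hypothesis N0 : (0 < N)%N.
Implicit Types (a b c d k : nat).

Let NR0 : N%:R != 0 :> R. Proof. by rewrite pnatr_eq0 -lt0n. Qed.

Definition arc a b c : bool := (a <= c)%N (+) (b <= c)%N.
Definition coarc c d a : bool := (a <= c)%N (+) (a <= d)%N.

(** The pair {a, b} separates c from d.  Half-open arcs make the averages
    [mean_interlace_r] and [mean_interlace_l] exact even when points
    coincide. *)
Definition interlace a b c d : bool := arc a b c (+) arc a b d.

Lemma interlace_coarc a b c d :
  interlace a b c d = coarc c d a (+) coarc c d b.
Proof. by rewrite /interlace /arc /coarc addbACA. Qed.

Lemma natr_addb (x y : bool) :
  (x (+) y)%:R = x%:R + y%:R - 2 * x%:R * y%:R :> R.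
Proof. by case: x; case: y => /=; ring. Qed.

Definition chord a b : R := `|a%:R - b%:R| / N%:R.

Lemma chordC a b : chord a b = chord b a.
Proof. by rewrite /chord distrC. Qed.

Lemma sum_geq a : (a <= N)%N -> \sum_(v < N) (a <= v)%N%:R = N%:R - a%:R :> R.
Proof.
move=> aN; rewrite -natrB// -natr_sum; congr (_ %:R).
elim: N aN => [|n IH] an; first by rewrite big_ord0 sub0n.
move: an; rewrite leq_eqVlt => /orP[/eqP ->|].
  rewrite subnn big1// => i _; have := ltn_ord i; lia.
by rewrite ltnS => an; rewrite big_ord_recr /= IH// an; lia.
Qed.

Lemma sum_leq a : (a < N)%N -> \sum_(v < N) (v <= a)%N%:R = 1 + a%:R :> R.
Proof.
move=> aN.
have h : \sum_(v < N) (v <= a)%N%:R = \sum_(v < N) (1 - (a.+1 <= v)%N%:R) :> R.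
  apply: eq_bigr => v _; case: (leqP v a) => /= h; first by rewrite subr0.
  by rewrite subrr.
rewrite h sumrB sum_geq// sumr_const card_ord -natr1; ring.
Qed.

Lemma mean_arc a b : (a < N)%N -> (b < N)%N ->
  mean (fun v : 'I_N => (arc a b v)%:R) = chord a b.
Proof.
have main x y : (x <= y)%N -> (x < N)%N -> (y < N)%N ->
    mean (fun v : 'I_N => (arc x y v)%:R) = chord x y.
  move=> xy xN yN; rewrite /mean card_ord /chord; congr (_ / _).
  rewrite (eq_bigr (fun v : 'I_N => (x <= v)%N%:R - (y <= v)%N%:R)); last first.
    move=> v _; rewrite /arc; case: (leqP y v) => yv /=.
      by rewrite (leq_trans xy yv) subrr.
    by case: (leqP x v) => _; rewrite subr0.
  rewrite sumrB !sum_geq ?(ltnW xN) ?(ltnW yN)// ler0_norm ?subr_le0 ?ler_nat//.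
  by ring.
move=> aN bN; case: (leqP a b) => ab; first exact: main.
rewrite chordC -main ?(ltnW ab)//; apply: eq_mean => v.
by rewrite /arc addbC.
Qed.

Lemma mean_coarc c d : (c < N)%N -> (d < N)%N ->
  mean (fun v : 'I_N => (coarc c d v)%:R) = chord c d.
Proof.
have main x y : (x <= y)%N -> (x < N)%N -> (y < N)%N ->
    mean (fun v : 'I_N => (coarc x y v)%:R) = chord x y.
  move=> xy xN yN; rewrite /mean card_ord /chord; congr (_ / _).
  rewrite (eq_bigr (fun v : 'I_N => (v <= y)%N%:R - (v <= x)%N%:R)); last first.
    move=> v _; rewrite /coarc; case: (leqP v x) => vx /=.
      by rewrite (leq_trans vx xy) subrr.
    by case: (leqP v y) => _; rewrite subr0.
  rewrite sumrB !sum_leq// ler0_norm ?subr_le0 ?ler_nat//.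
  by ring.
move=> cN dN; case: (leqP c d) => cd; first exact: main.
rewrite chordC -main ?(ltnW cd)//; apply: eq_mean => v.
by rewrite /coarc addbC.
Qed.

(** The probability that two independent uniform points are separated by a and
    b. *)
Definition arcprob a b : R := 2 * chord a b * (1 - chord a b).

Lemma mean_xor (f : 'I_N -> bool) p : mean (fun v => (f v)%:R) = p ->
  mean (fun v => mean (fun w => (f v (+) f w)%:R)) = 2 * p * (1 - p) :> R.
Proof.
move=> fp; have c0 : (0 < #|'I_N|)%N by rewrite card_ord.
have e v : mean (fun w => (f v (+) f w)%:R) = (1 - 2 * p) * (f v)%:R + p.
  rewrite (eq_mean (G := fun w => (1 - 2 * (f v)%:R) * (f w)%:R + (f v)%:R)).
    by rewrite meanD meanZ mean_cst// fp; ring.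
  by move=> w; rewrite natr_addb; ring.
by rewrite (eq_mean e) meanD meanZ mean_cst// fp; ring.
Qed.

Lemma mean_interlace_r a b : (a < N)%N -> (b < N)%N ->
  mean (fun v : 'I_N => mean (fun w : 'I_N => (interlace a b v w)%:R)) = arcprob a b.
Proof. by move=> aN bN; rewrite (mean_xor (mean_arc aN bN)). Qed.

Lemma mean_interlace_l c d : (c < N)%N -> (d < N)%N ->
  mean (fun v : 'I_N => mean (fun w : 'I_N => (interlace v w c d)%:R)) = arcprob c d.
Proof.
move=> cN dN; rewrite -[RHS](mean_xor (mean_coarc cN dN)).
by apply: eq_mean => v; apply: eq_mean => w; rewrite interlace_coarc.
Qed.

(** The symmetry of phi makes phi |a - b| a function of the circular distance,
    so its sum over b does not depend on a: shifting a by one replaces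
    phi (N - (a + 1)) by phi (a + 1). *)
Lemma sum_dist_shift (phi : R -> R) a : (forall k, (k <= N)%N ->
    phi k%:R = phi (N - k)%N%:R) -> (a < N)%N ->
  \sum_(b < N) phi `|a%:R - b%:R| = \sum_(k < N) phi k%:R.
Proof.
move=> phiN; elim: a => [|a IH] aN.
  by apply: eq_bigr => b _; rewrite sub0r normrN ger0_norm.
rewrite -IH; last exact: ltnW.
case: N phiN aN {IH} => [//|n] phiN aN.
rewrite big_ord_recl [RHS]big_ord_recr /= addrC; congr (_ + _); last first.
  by apply: eq_bigr => b _; rewrite /bump add1n -!natr1; congr (phi `|_|); ring.
rewrite subr0 ger0_norm// phiN; last exact: ltnW.
rewrite ler0_norm ?subr_le0 ?ler_nat; last by lia.
by rewrite opprB -natrB ?subSS//; lia.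
Qed.

Definition meanprob : R := (1 - N%:R ^- 2) / 3.
(** The variance of 2 p (1 - p) for p uniform on the multiples of 1 / N; it
    tends to 1 / 45. *)
Definition varprob : R :=
  45^-1 + 2 / 9 * N%:R ^- 2 - (2 / 15 + 9^-1) * N%:R ^- 4.

Let phi (r : R) := 2 * (r / N%:R) * (1 - r / N%:R).

Let phi_sym k : (k <= N)%N -> phi k%:R = phi (N - k)%N%:R.
Proof. by move=> kN; rewrite /phi natrB//; field. Qed.

Let sum_phi : \sum_(k < N) phi k%:R = N%:R * meanprob.
Proof.
have h M : \sum_(k < M) phi k%:R =
   (N%:R * (M%:R * (M%:R - 1) / 2) - (M%:R - 1) * M%:R * (2 * M%:R - 1) / 6) * 2 / N%:R ^+ 2.
  elim: M => [|M IH]; first by rewrite big_ord0; ring.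
  by rewrite big_ord_recr /= IH -natr1 /phi; field.
by rewrite h /meanprob; field.
Qed.

Let sum_phi2 : \sum_(k < N) phi k%:R ^+ 2 = N%:R * (2 / 15 * (1 - N%:R ^- 4)).
Proof.
have h M : \sum_(k < M) phi k%:R ^+ 2 =
   (N%:R ^+ 2 * ((M%:R - 1) * M%:R * (2 * M%:R - 1) / 6)
    - 2 * N%:R * (M%:R * (M%:R - 1) / 2) ^+ 2
    + M%:R * (M%:R - 1) * (2 * M%:R - 1) * (3 * M%:R ^+ 2 - 3 * M%:R - 1) / 30)
     * 4 / N%:R ^+ 4.
  elim: M => [|M IH]; first by rewrite big_ord0; ring.
  by rewrite big_ord_recr /= IH -natr1 /phi; field.
by rewrite h; field.
Qed.

Lemma mean_arcprob a : (a < N)%N ->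
  mean (fun b : 'I_N => arcprob a b) = meanprob.
Proof.
move=> aN; rewrite /mean card_ord.
rewrite (eq_bigr (fun b : 'I_N => phi `|a%:R - b%:R|)) => [|b _]; last by [].
by rewrite sum_dist_shift// sum_phi mulrC mulKf.
Qed.

Lemma arcprobC a b : arcprob a b = arcprob b a.
Proof. by rewrite /arcprob chordC. Qed.

Lemma mean_arcprob_sqr a : (a < N)%N ->
  mean (fun b : 'I_N => (arcprob a b - meanprob) ^+ 2) = varprob.
Proof.
move=> aN; have c0 : (0 < #|'I_N|)%N by rewrite card_ord.
have e : mean (fun b : 'I_N => arcprob a b ^+ 2) = 2 / 15 * (1 - N%:R ^- 4).
  rewrite /mean card_ord.
  rewrite (eq_bigr (fun b : 'I_N => phi `|a%:R - b%:R| ^+ 2)) => [|b _]; last by [].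
  rewrite (sum_dist_shift (phi := fun r => phi r ^+ 2))// => [|k kN].
    by rewrite sum_phi2 mulrC mulKf.
  by rewrite phi_sym.
rewrite (eq_mean (G := fun b : 'I_N => arcprob a b ^+ 2 +
   ((- 2 * meanprob) * arcprob a b + meanprob ^+ 2))) => [|b]; last by ring.
rewrite meanD meanD meanZ mean_cst// e mean_arcprob// /varprob /meanprob.
by field.
Qed.

Lemma arcprob_bound a b : (a < N)%N -> (b < N)%N -> 0 <= arcprob a b <= 1.
Proof.
move=> aN bN; have NR : 0 < N%:R :> R by rewrite ltr0n.
have c0 : 0 <= chord a b by rewrite divr_ge0.
have c1 : chord a b <= 1.
  rewrite ler_pdivrMr// mul1r.
  have : a%:R <= N%:R :> R by rewrite ler_nat ltnW.
  have : b%:R <= N%:R :> R by rewrite ler_nat ltnW.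
  have : 0 <= a%:R :> R by []. have : 0 <= b%:R :> R by [].
  by move=> ? ? ? ?; rewrite ler_norml; apply/andP; split; lra.
by rewrite /arcprob; apply/andP; split; nra.
Qed.

Lemma meanprob_bound : 0 <= meanprob <= 1.
Proof.
have NR : 1 <= N%:R :> R by rewrite ler1n.
have h1 : 0 <= N%:R ^- 2 :> R by rewrite invr_ge0 exprn_ge0.
have h2 : N%:R ^- 2 <= 1 :> R by rewrite invf_le1 ?exprn_ege1 ?exprn_gt0 ?(lt_le_trans ltr01).
by rewrite /meanprob; apply/andP; split; lra.
Qed.

End ArcLength.

(** * Pairs of edges of a regular graph *)

Section RegularGraph.
Variables (R : realType) (V : finType) (E : {set V * V}) (d : nat).
Hypothesis sE : simple_graph E.
Hypothesis rE : forall v, degree E v = d.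
Local Notation Q := ((V * V) * (V * V))%type.
Local Notation nn := (#|V|%:R : R).
Local Notation dd := (d%:R : R).
Implicit Types (e f : V * V) (q : Q).

Definition swap (e : V * V) := (e.2, e.1).
Definition ends (e : V * V) : seq V := [:: e.1; e.2].
Definition corners (q : Q) : seq V := ends q.1 ++ ends q.2.

(** Ordered pairs of disjoint oriented edges: every unordered pair of disjoint
    edges occurs 8 times. *)
Definition quads : {set Q} :=
  [set q | [&& q.1 \in E, q.2 \in E & uniq (corners q)]]%SET.

Lemma edge_neq e : e \in E -> e.1 != e.2.
Proof.
case: e => a b /= abE; apply/eqP => ab; move: abE; rewrite -ab.
by case/andP: sE => /forallP/(_ a) /negP.
Qed.

Lemma edge_swap e : (swap e \in E) = (e \in E).
Proof.
by case: e => a b; case/andP: sE => _ /forallP/(_ a)/forallP/(_ b)/eqP ->.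
Qed.

Lemma swapK : involutive swap. Proof. by case. Qed.

Lemma sum_swap (F : V * V -> R) : \sum_(e in E) F (swap e) = \sum_(e in E) F e.
Proof.
rewrite [RHS](reindex_inj (can_inj swapK)) /=.
by apply: eq_bigl => e; rewrite edge_swap.
Qed.

Lemma sum_fst (x : V) : \sum_(e in E) (e.1 == x)%:R = dd.
Proof.
rewrite -natr_sum -(rE x) /degree; congr (_ %:R).
rewrite -sum1dep_card (eq_bigl (fun e => true && ((e.1, e.2) \in E))); last by case.
rewrite -(pair_big_dep (fun=> true) (fun a b => (a, b) \in E)
  (fun a b => nat_of_bool (a == x))) /=.
rewrite (bigD1 x)//= [X in (_ + X)%N]big1 ?addn0; last first.
  by move=> a /negbTE ax; rewrite big1// => b _; rewrite ax.
by apply: eq_big => b; rewrite ?inE ?eqxx.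
Qed.

Lemma sum_snd (x : V) : \sum_(e in E) (e.2 == x)%:R = dd.
Proof. by rewrite -(sum_fst x) -sum_swap. Qed.

Lemma sum_edges1 : \sum_(e in E) 1 = nn * dd.
Proof.
transitivity (\sum_(e in E) \sum_(x : V) ((e.1 == x)%:R : R)).
  apply: eq_bigr => e _; rewrite (bigD1 e.1)//= eqxx big1 ?addr0// => x.
  by rewrite eq_sym => /negbTE ->.
rewrite exchange_big /= (eq_bigr (fun=> dd)) => [|x _]; last exact: sum_fst.
by rewrite sumr_const [RHS]mulr_natl.
Qed.

Lemma sum_quads (F : Q -> R) : \sum_(q in quads) F q =
  \sum_(e in E) \sum_(f in E) (uniq (corners (e, f)))%:R * F (e, f).
Proof.
rewrite pair_big /= big_mkcond /= [RHS]big_mkcond /=; apply: eq_bigr => -[e f] _.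
rewrite inE /=; case: (e \in E); case: (f \in E) => //=.
by case: ifP => _; rewrite ?mul1r ?mul0r.
Qed.

Lemma sum_quads_le (F : Q -> R) : (forall q, 0 <= F q) ->
  \sum_(q in quads) F q <= \sum_(e in E) \sum_(f in E) F (e, f).
Proof.
move=> F0; rewrite sum_quads; apply: ler_sum => e _; apply: ler_sum => f _.
by case: (uniq _); rewrite ?mul1r ?mul0r.
Qed.

Lemma sum_mem_seq (x : V) (s : seq V) : x \in s ->
  1 <= \sum_(y <- s) (x == y)%:R :> R.
Proof.
move=> xs; rewrite (big_rem x)//= eqxx lerDl.
by apply: sumr_ge0 => y _.
Qed.

(** The number of incidences of the edge e with the corners of q; it serves as
    an upper bound for the indicator that e meets q. *)
Definition touch q e : R := \sum_(x <- corners q) ((e.1 == x)%:R + (e.2 == x)%:R).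

Lemma touch_ge0 q e : 0 <= touch q e.
Proof. by apply: sumr_ge0 => x _; rewrite addr_ge0. Qed.

Lemma touch_ge1 q e : has (mem (corners q)) (ends e) -> 1 <= touch q e.
Proof.
rewrite /touch big_split /= orbF => /orP[] /sum_mem_seq h.
  by rewrite (le_trans h)// lerDl sumr_ge0.
by rewrite (le_trans h)// lerDr sumr_ge0.
Qed.

Lemma sum_touch q : \sum_(e in E) touch q e = 8 * dd.
Proof.
rewrite /touch exchange_big /= (eq_bigr (fun=> 2 * dd)) => [|x _].
  by rewrite !big_cons big_nil; ring.
by rewrite big_split /= sum_fst sum_snd; ring.
Qed.

Lemma mem_corners_le (i : V) q : (i \in corners q)%:R <=
  (q.1.1 == i)%:R + (q.1.2 == i)%:R + ((q.2.1 == i)%:R + (q.2.2 == i)%:R) :> R.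
Proof.
rewrite -!natrD ler_nat !inE !(eq_sym i).
by do 4!case: (_ == i).
Qed.

Lemma sum_quads_at (i : V) :
  \sum_(q in quads) (i \in corners q)%:R <= 4 * nn * dd ^+ 2.
Proof.
pose F q : R :=
  (q.1.1 == i)%:R + (q.1.2 == i)%:R + ((q.2.1 == i)%:R + (q.2.2 == i)%:R).
apply: (@le_trans _ _ (\sum_(q in quads) F q)).
  by apply: ler_sum => q _; exact: mem_corners_le.
apply: le_trans (sum_quads_le _) _; first by move=> q; rewrite /F !addr_ge0.
rewrite /F (eq_bigr (fun e => ((e.1 == i)%:R + (e.2 == i)%:R) * (nn * dd) + 2 * dd * 1)).
  rewrite big_split /= -mulr_suml big_split /= sum_fst sum_snd -mulr_sumr sum_edges1.
  by rewrite le_eqVlt; apply/orP; left; apply/eqP; ring.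
move=> e _ /=; rewrite big_split /= -sum_edges1 mulr_sumr; congr (_ + _).
  by apply: eq_bigr => f _; rewrite mulr1.
by rewrite big_split /= sum_fst sum_snd; ring.
Qed.

Lemma card_quads_le : \sum_(q in quads) 1 <= (nn * dd) ^+ 2.
Proof.
apply: le_trans (sum_quads_le _) _ => //.
rewrite (eq_bigr (fun=> nn * dd * 1)) => [|e _]; last by rewrite mulr1 sum_edges1.
by rewrite -mulr_sumr sum_edges1 expr2.
Qed.

Lemma sum_corners q : q \in quads -> \sum_(i : V) (i \in corners q)%:R = 4 :> R.
Proof.
rewrite inE => /and3P[_ _ uq].
rewrite -natr_sum; have <- : #|corners q| = 4%N by rewrite (card_uniqP uq).
rewrite -sum1_card [in RHS]big_mkcond; congr (_ %:R).
Qed.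

Lemma uniq_corners_swap e f : uniq (corners (e, f)) = uniq (corners (f, e)).
Proof. by rewrite /corners uniq_catC. Qed.

(** The number of oriented edges disjoint from a given edge. *)
Definition codegree : R := nn * dd - 4 * dd + 2.

Lemma sum_delta e (F : V * V -> R) : e \in E ->
  \sum_(f in E) (f == e)%:R * F f = F e.
Proof.
move=> eE; rewrite (bigD1 e)//= eqxx mul1r big1 ?addr0// => f /andP[_ /negbTE ->].
by rewrite mul0r.
Qed.

(** By inclusion-exclusion: the only edges that meet e at both ends are e and
    its reverse. *)
Lemma sum_disjoint e : e \in E ->
  \sum_(f in E) (uniq (corners (e, f)))%:R = codegree.
Proof.
move=> eE; have ab := edge_neq eE.
rewrite (eq_bigr (fun f => 1 - ((f.1 == e.1)%:R + (f.1 == e.2)%:R +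
   (f.2 == e.1)%:R + (f.2 == e.2)%:R) + ((f == e)%:R * 1 + (f == swap e)%:R * 1))).
  rewrite big_split /= sumrB !big_split /= !sum_fst !sum_snd !sum_delta ?edge_swap//.
  by rewrite sum_edges1 /codegree; ring.
move=> f fE; have cd := edge_neq fE.
case: e f ab cd {eE fE} => a b [c e] /= ab ce.
rewrite /swap /= !xpair_eqE /= !inE !negb_or ab ce !andbT /=.
rewrite ![_ == c]eq_sym ![_ == e]eq_sym.
case: (eqVneq c a) => [ca|_]; case: (eqVneq c b) => [cb|_];
  case: (eqVneq e a) => [ea|_]; case: (eqVneq e b) => [eb|_] /=; try ring.
all: exfalso; move: ab ce; subst; rewrite ?eqxx //.
Qed.

Lemma sum_quads_fst (F : V * V -> R) :
  \sum_(q in quads) F q.1 = codegree * \sum_(e in E) F e.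
Proof.
rewrite sum_quads mulr_sumr; apply: eq_bigr => e eE /=.
by rewrite -mulr_suml sum_disjoint.
Qed.

Lemma sum_quads_snd (F : V * V -> R) :
  \sum_(q in quads) F q.2 = codegree * \sum_(e in E) F e.
Proof.
rewrite sum_quads exchange_big /= mulr_sumr; apply: eq_bigr => e eE /=.
rewrite -mulr_suml -(sum_disjoint eE); congr (_ * _); apply: eq_bigr => f _.
by rewrite uniq_corners_swap.
Qed.

(** * Decomposition of the crossing count *)

Section Kernels.
Variable N : nat.
Hypothesis N0 : (0 < N)%N.
Local Notation Om := {ffun V -> 'I_N}.

Let I0 : (0 < #|'I_N|)%N. Proof. by rewrite card_ord. Qed.

Definition supported (s : seq V) (F : Om -> R) := forall i, i \notin s -> indep i F.

(** If an edge of p is disjoint from q, averaging over the two ends of this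
    edge kills the product of the terms of p and q.  Hence only the p both of
    whose edges meet q count, and these are at most (8 d) ^ 2. *)
Lemma second_moment (K : Q -> Om -> R) (B : R) : 0 <= B ->
  (forall q, supported (corners q) (K q)) ->
  (forall q u, `|K q u| <= B) ->
  (forall q, q \in quads -> avg q.1.1 (avg q.1.2 (K q)) =1 (fun=> 0)) ->
  (forall q, q \in quads -> avg q.2.1 (avg q.2.2 (K q)) =1 (fun=> 0)) ->
  mean (fun u => (\sum_(q in quads) K q u) ^+ 2) <= (8 * B * dd ^+ 2 * nn) ^+ 2.
Proof.
move=> B0 sK bK c1 c2.
have -> : mean (fun u => (\sum_(q in quads) K q u) ^+ 2) =
    \sum_(q in quads) \sum_(p in quads) mean (fun u => K q u * K p u).
  rewrite (eq_mean (G := fun u =>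
      \sum_(q in quads) \sum_(p in quads) K q u * K p u)) => [|u].
    by rewrite mean_sum; apply: eq_bigr => q _; rewrite mean_sum.
  by rewrite expr2 mulr_suml; apply: eq_bigr => q _; rewrite mulr_sumr.
have pw q p : p \in quads ->
    mean (fun u => K q u * K p u) <= B ^+ 2 * (touch q p.1 * touch q p.2).
  move=> pQ.
  have t12 : 0 <= touch q p.1 * touch q p.2 by rewrite mulr_ge0 ?touch_ge0.
  have z0 : 0 <= B ^+ 2 * (touch q p.1 * touch q p.2) by rewrite mulr_ge0 ?sqr_ge0.
  have [h1|h1] := boolP (has (mem (corners q)) (ends p.1)); last first.
    rewrite (mean_orthogonal I0 (i := p.1.1) (j := p.1.2))//.
    - by apply: sK; apply: contra h1 => /= ->.
    - by apply: sK; apply: contra h1 => /= ->; rewrite orbT.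
    - exact: c1.
  have [h2|h2] := boolP (has (mem (corners q)) (ends p.2)); last first.
    rewrite (mean_orthogonal I0 (i := p.2.1) (j := p.2.2))//.
    - by apply: sK; apply: contra h2 => /= ->.
    - by apply: sK; apply: contra h2 => /= ->; rewrite orbT.
    - exact: c2.
  apply: (@le_trans _ _ (B ^+ 2)).
    rewrite -[leRHS](mean_cst (B ^+ 2) (Om_card0 V I0)); apply: ler_mean => u.
    by apply: le_trans (ler_norm _) _; rewrite normrM expr2 ler_pM.
  by rewrite ler_peMr ?sqr_ge0// -[1]mulr1 ler_pM ?touch_ge1.
apply: (@le_trans _ _ (\sum_(q in quads) B ^+ 2 * (8 * dd) ^+ 2)).
  apply: ler_sum => q _.
  apply: (@le_trans _ _ (\sum_(p in quads) B ^+ 2 * (touch q p.1 * touch q p.2))).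
    by apply: ler_sum => p; exact: pw.
  rewrite -mulr_sumr ler_wpM2l ?sqr_ge0//.
  apply: le_trans (sum_quads_le _) _.
    by move=> p; rewrite mulr_ge0 ?touch_ge0.
  rewrite /= (eq_bigr (fun e => touch q e * (8 * dd))) => [|e _].
    by rewrite -mulr_suml sum_touch expr2.
  by rewrite -mulr_sumr sum_touch.
rewrite (eq_bigr (fun=> (B ^+ 2 * (8 * dd) ^+ 2) * 1)) => [|q _]; last by rewrite mulr1.
rewrite -mulr_sumr; apply: le_trans (ler_wpM2l _ card_quads_le) _.
  by rewrite mulr_ge0 ?sqr_ge0.
by rewrite le_eqVlt; apply/orP; left; apply/eqP; ring.
Qed.

Definition gcross q (u : Om) : R :=
  (interlace (u q.1.1) (u q.1.2) (u q.2.1) (u q.2.2))%:R.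

(** The fluctuation of the probability that a given disjoint edge crosses e. *)
Definition chordexc e (u : Om) : R :=
  arcprob R N (u e.1) (u e.2) - meanprob R N.

(** What remains of the crossing indicator after subtraction of its
    conditional expectations given one of the two edges. *)
Definition pairexc q (u : Om) : R :=
  gcross q u - (chordexc q.1 u + chordexc q.2 u + meanprob R N).

Lemma corners_inE (i : V) q : (i \in corners q) =
  [|| i == q.1.1, i == q.1.2, i == q.2.1 | i == q.2.2].
Proof. by rewrite !inE. Qed.

Lemma supported_chordexc e : supported (ends e) (chordexc e).
Proof.
move=> i; rewrite !inE negb_or => /andP[h1 h2] u v.
by rewrite /chordexc !upd_other// eq_sym.
Qed.

Lemma supported_gcross q : supported (corners q) (gcross q).
Proof.
move=> i; rewrite corners_inE !negb_or => /and4P[h1 h2 h3 h4] u v.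
by rewrite /gcross !upd_other// eq_sym.
Qed.

Lemma supported_pairexc q : supported (corners q) (pairexc q).
Proof.
move=> i ic u v; rewrite /pairexc (supported_gcross ic).
have := ic; rewrite /corners mem_cat negb_or => /andP[h1 h2].
by rewrite (supported_chordexc h1) (supported_chordexc h2).
Qed.

Lemma chordexc_swap e u : chordexc (swap e) u = chordexc e u.
Proof. by rewrite /chordexc arcprobC. Qed.

Lemma avg_chordexc_snd e : e.1 != e.2 -> avg e.2 (chordexc e) =1 (fun=> 0).
Proof.
move=> ne u; rewrite /avg /chordexc.
rewrite (eq_mean (G := fun v : 'I_N => arcprob R N (u e.1) v - meanprob R N)).
  by rewrite meanB mean_cst// mean_arcprob// subrr.
by move=> v; rewrite upd_same upd_other.
Qed.

Lemma avg_chordexc_fst e : e.1 != e.2 -> avg e.1 (chordexc e) =1 (fun=> 0).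
Proof.
move=> ne u; rewrite -[e.1]/((swap e).2) (eq_avg (G := chordexc (swap e))).
  by rewrite avg_chordexc_snd// eq_sym.
by move=> w; rewrite chordexc_swap.
Qed.

Lemma mean_chordexc_sqr e : e.1 != e.2 ->
  mean (fun u => chordexc e u ^+ 2) = varprob R N.
Proof.
move=> ne; rewrite -(mean_avg I0 e.2).
rewrite (eq_mean (G := fun=> varprob R N)) ?mean_cst ?Om_card0// => u.
rewrite /avg -(mean_arcprob_sqr R N0 (ltn_ord (u e.1))).
by apply: eq_mean => v; rewrite /chordexc upd_same upd_other.
Qed.

(** Unless e and f have the same two ends, one end of f lies outside e, and
    averaging over this end alone kills chordexc f. *)
Lemma mean_chordexc_mul e f : e.1 != e.2 -> f.1 != f.2 ->
  mean (fun u => chordexc e u * chordexc f u) =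
  varprob R N * ((f == e)%:R + (f == swap e)%:R).
Proof.
move=> ne nf.
have [->|fe] := eqVneq f e.
  have -> : (e == swap e) = false.
    by apply/negbTE; case: e ne => a b /=; rewrite xpair_eqE negb_and => ->.
  by rewrite addr0 mulr1 -(mean_chordexc_sqr ne); apply: eq_mean => u; rewrite expr2.
have [->|fs] := eqVneq f (swap e).
  rewrite add0r mulr1 -(mean_chordexc_sqr ne); apply: eq_mean => u.
  by rewrite chordexc_swap expr2.
rewrite addr0 mulr0.
have [i [ii iz]] : exists i, i \notin ends e /\ avg i (chordexc f) =1 (fun=> 0).
  have [h|h] := boolP (f.1 \in ends e); last first.
    by exists f.1; split=> //; exact: avg_chordexc_fst.
  exists f.2; split; last exact: avg_chordexc_snd.
  move: h fe fs nf; case: (e) (f) => a b [x y] /=; rewrite /swap !inE !xpair_eqE /= => h h1 h2.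
  case/orP: h h1 h2 => /eqP ->; rewrite eqxx /= => h1 h2 h3; rewrite negb_or.
    by rewrite h1 andbT eq_sym.
  by rewrite h2 /= eq_sym.
by apply: (mean_orthogonal1 I0 (i := i)) => //; exact: supported_chordexc.
Qed.

Lemma avg2_gcross_snd q : q \in quads ->
  avg q.2.1 (avg q.2.2 (gcross q)) =1 (fun u => arcprob R N (u q.1.1) (u q.1.2)).
Proof.
rewrite inE => /and3P[_ _ /=]; rewrite !inE !negb_or.
move=> /and4P[/and3P[h1 h2 h3] /andP[h4 h5] h6 _] u.
rewrite -(mean_interlace_r R N0 (ltn_ord (u q.1.1)) (ltn_ord (u q.1.2))).
apply: eq_mean => v; apply: eq_mean => w.
by rewrite /gcross upd_same !(upd_other _ _ h6, upd_other _ _ h3, upd_other _ _ h5,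
  upd_other _ _ h2, upd_other _ _ h4, upd_same).
Qed.

Lemma avg2_gcross_fst q : q \in quads ->
  avg q.1.1 (avg q.1.2 (gcross q)) =1 (fun u => arcprob R N (u q.2.1) (u q.2.2)).
Proof.
rewrite inE => /and3P[_ _ /=]; rewrite !inE !negb_or.
move=> /and4P[/and3P[h1 h2 h3] /andP[h4 h5] h6 _] u.
rewrite -(mean_interlace_l R N0 (ltn_ord (u q.2.1)) (ltn_ord (u q.2.2))).
apply: eq_mean => v; apply: eq_mean => w.
by rewrite /gcross upd_same !(upd_other _ _ h1);
 rewrite eq_sym in h2; rewrite eq_sym in h3; rewrite eq_sym in h4; rewrite eq_sym in h5;
 rewrite !(upd_other _ _ h2, upd_other _ _ h3, upd_other _ _ h5,
  upd_other _ _ h4, upd_same).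
Qed.

Lemma quads_edges q : q \in quads -> q.1.1 != q.1.2 /\ q.2.1 != q.2.2.
Proof. by rewrite inE => /and3P[h1 h2 _]; rewrite !edge_neq. Qed.

Lemma quads_ends q : q \in quads -> [/\ q.1.1 \notin ends q.2,
  q.1.2 \notin ends q.2, q.2.1 \notin ends q.1 & q.2.2 \notin ends q.1].
Proof.
rewrite inE => /and3P[_ _ /=]; rewrite !inE !negb_or.
move=> /and4P[/and3P[h1 h2 h3] /andP[h4 h5] h6 _].
by rewrite h2 h3 h4 h5 ![q.2.1 == _]eq_sym ![q.2.2 == _]eq_sym h2 h3 h4 h5.
Qed.

Lemma avgDc (i : V) (F : Om -> R) (c : R) u : avg i (fun u => F u + c) u = avg i F u + c.
Proof. by rewrite avgD (avg_indep I0 (F := fun=> c)). Qed.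

Lemma pairexc_centered_snd q : q \in quads ->
  avg q.2.1 (avg q.2.2 (pairexc q)) =1 (fun=> 0).
Proof.
move=> qQ u; have [n1 n2] := quads_edges qQ; have [k1 k2 k3 k4] := quads_ends qQ.
rewrite (eq_avg (G := fun u => avg q.2.2 (gcross q) u - (chordexc q.1 u + meanprob R N))).
  rewrite avgB avg2_gcross_snd// avgDc (avg_indep I0 (supported_chordexc k3)).
  by rewrite /chordexc; ring.
move=> w; rewrite avgB avgDc (avgD _ (chordexc q.1) (chordexc q.2)).
by rewrite (avg_indep I0 (supported_chordexc k4)) (avg_chordexc_snd n2) addr0.
Qed.

Lemma pairexc_centered_fst q : q \in quads ->
  avg q.1.1 (avg q.1.2 (pairexc q)) =1 (fun=> 0).
Proof.
move=> qQ u; have [n1 n2] := quads_edges qQ; have [k1 k2 k3 k4] := quads_ends qQ.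
rewrite (eq_avg (G := fun u => avg q.1.2 (gcross q) u - (chordexc q.2 u + meanprob R N))).
  rewrite avgB avg2_gcross_fst// avgDc (avg_indep I0 (supported_chordexc k1)).
  by rewrite /chordexc; ring.
move=> w; rewrite avgB avgDc (avgD _ (chordexc q.1) (chordexc q.2)).
by rewrite (avg_indep I0 (supported_chordexc k2)) (avg_chordexc_snd n1) add0r.
Qed.

Lemma chordexc_bound e u : `|chordexc e u| <= 1.
Proof.
have /andP[a0 a1] := arcprob_bound R N0 (ltn_ord (u e.1)) (ltn_ord (u e.2)).
have /andP[b0 b1] := meanprob_bound R N0.
by rewrite /chordexc ler_norml; apply/andP; split; lra.
Qed.

Lemma gcross_bound q u : 0 <= gcross q u <= 1.
Proof. by rewrite /gcross; case: interlace; rewrite ?lexx ?ler01. Qed.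

Lemma pairexc_bound q u : `|pairexc q u| <= 4.
Proof.
have /andP[a0 a1] := gcross_bound q u.
have /andP[b0 b1] := meanprob_bound R N0.
have := chordexc_bound q.1 u; have := chordexc_bound q.2 u.
rewrite /pairexc !ler_norml => /andP[? ?] /andP[? ?].
by apply/andP; split; lra.
Qed.

(** Resampling every corner in turn drifts pairexc by 2 * (pairexc + regexc).
    The regression with rate 2 / n would be exact if this term vanished; it is
    centred given either edge, hence as negligible as pairexc. *)
Definition regexc q (u : Om) : R :=
  2^-1 * \sum_(i <- corners q) (pairexc q u - avg i (pairexc q) u) - pairexc q u.

Lemma supported_regexc q : supported (corners q) (regexc q).
Proof.
move=> i ic u v; rewrite /regexc (supported_pairexc ic); congr (_ * _ - _).
apply: eq_bigr => j _; congr (_ - _).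
by apply: indep_avg_other; exact: supported_pairexc.
Qed.

Lemma avg_bound (i : V) (F : Om -> R) (c : R) u : (forall u, `|F u| <= c) -> `|avg i F u| <= c.
Proof.
move=> bF; apply: le_trans (ler_norm_mean _) _.
by rewrite -[leRHS](mean_cst c I0); apply: ler_mean.
Qed.

Lemma regexc_bound q u : `|regexc q u| <= 20.
Proof.
have b := pairexc_bound q.
have a i : `|pairexc q u - avg i (pairexc q) u| <= 8.
  apply: le_trans (ler_normB _ _) _; have := b u; have := avg_bound i u b; lra.
rewrite /regexc !big_cons big_nil addr0.
have := b u; have := a q.1.1; have := a q.1.2; have := a q.2.1; have := a q.2.2.
rewrite !ler_norml => /andP[? ?] /andP[? ?] /andP[? ?] /andP[? ?] /andP[? ?].
by apply/andP; split; lra.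
Qed.

Lemma regexc_centered (i j : V) q : avg i (avg j (pairexc q)) =1 (fun=> 0) ->
  avg i (avg j (regexc q)) =1 (fun=> 0).
Proof.
move=> z u.
have z3 k w : avg i (avg j (avg k (pairexc q))) w = 0.
  rewrite (eq_avg (G := avg k (avg j (pairexc q)))); last exact: avg_comm.
  rewrite avg_comm (eq_avg (G := fun=> 0)) //.
  by rewrite avg_indep.
rewrite (eq_avg (G := fun u => 2^-1 * \sum_(k <- corners q)
  (avg j (pairexc q) u - avg j (avg k (pairexc q)) u) - avg j (pairexc q) u)).
  rewrite avgB z subr0 avgZ avg_sum big1 ?mulr0// => k _.
  by rewrite avgB z z3 subrr.
move=> w; rewrite avgB avgZ avg_sum; congr (_ * _ - _).
by apply: eq_bigr => k _; rewrite avgB.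
Qed.

(** The number of crossings, for distinct positions: the factor 8 ^-1 undoes the
    orientations and the order of the pairs in [quads]. *)
Definition crossX (u : Om) : R := 8^-1 * \sum_(q in quads) gcross q u.
Definition linpart (u : Om) : R := codegree / 4 * \sum_(e in E) chordexc e u.
Definition degpart (u : Om) : R := 8^-1 * \sum_(q in quads) pairexc q u.
Definition regpart (u : Om) : R := 8^-1 * \sum_(q in quads) regexc q u.
Definition crossmean : R := codegree * (nn * dd) * meanprob R N / 8.

Lemma crossX_decomp u : crossX u = linpart u + degpart u + crossmean.
Proof.
have e : \sum_(q in quads) gcross q u =
    \sum_(q in quads) pairexc q u + \sum_(q in quads) chordexc q.1 u
    + \sum_(q in quads) chordexc q.2 u + \sum_(q in quads) meanprob R N.
  by rewrite -!big_split /=; apply: eq_bigr => q _; rewrite /pairexc; ring.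
have c : \sum_(q in quads) meanprob R N = codegree * (nn * dd) * meanprob R N.
  rewrite (sum_quads_fst (fun=> meanprob R N)).
  rewrite (eq_bigr (fun=> meanprob R N * 1)) => [|e' _]; last by rewrite mulr1.
  by rewrite -mulr_sumr sum_edges1; ring.
rewrite /crossX e c (sum_quads_fst (fun e => chordexc e u)).
rewrite (sum_quads_snd (fun e => chordexc e u)) /linpart /degpart /crossmean.
by field.
Qed.

Lemma mean_linpart_sqr : mean (fun u => linpart u ^+ 2) =
  codegree ^+ 2 * (nn * dd) * varprob R N / 8.
Proof.
rewrite (eq_mean (G := fun u => (codegree / 4) ^+ 2 *
    \sum_(e in E) \sum_(f in E) chordexc e u * chordexc f u)) => [|u]; last first.
  rewrite /linpart exprMn; congr (_ * _).
  by rewrite expr2 mulr_suml; apply: eq_bigr => q _; rewrite mulr_sumr.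
rewrite meanZ mean_sum.
rewrite (eq_bigr (fun=> 2 * varprob R N * 1)) => [|e eE].
  by rewrite -mulr_sumr sum_edges1; field.
rewrite mean_sum (eq_bigr (fun f => varprob R N *
    ((f == e)%:R * 1 + (f == swap e)%:R * 1))) => [|f fE].
  by rewrite -mulr_sumr big_split /= !sum_delta ?edge_swap//; ring.
by rewrite mean_chordexc_mul ?edge_neq// !mulr1.
Qed.

Lemma mean_degpart_sqr : mean (fun u => degpart u ^+ 2) <= (4 * dd ^+ 2 * nn) ^+ 2.
Proof.
rewrite (eq_mean (G := fun u => 8^-1 ^+ 2 * (\sum_(q in quads) pairexc q u) ^+ 2)).
  rewrite meanZ; have h : (0 : R) <= 4 by [].
  have := second_moment h supported_pairexc pairexc_bound
    pairexc_centered_fst pairexc_centered_snd.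
  lra.
by move=> u; rewrite /degpart exprMn.
Qed.

Lemma mean_regpart_sqr : mean (fun u => regpart u ^+ 2) <= (20 * dd ^+ 2 * nn) ^+ 2.
Proof.
rewrite (eq_mean (G := fun u => 8^-1 ^+ 2 * (\sum_(q in quads) regexc q u) ^+ 2)).
  rewrite meanZ; have h : (0 : R) <= 20 by [].
  have := second_moment h supported_regexc regexc_bound
    (fun q qQ => regexc_centered (pairexc_centered_fst qQ))
    (fun q qQ => regexc_centered (pairexc_centered_snd qQ)).
  lra.
by move=> u; rewrite /regpart exprMn.
Qed.

Lemma sum_avg_supported (s : seq V) (F : Om -> R) u : uniq s -> supported s F ->
  \sum_i (F u - avg i F u) = \sum_(i <- s) (F u - avg i F u).
Proof.
move=> us sF; rewrite [RHS]big_uniq//= [RHS]big_mkcond; apply: eq_bigr => i _.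
by case: ifPn => // /sF iF; rewrite avg_indep// subrr.
Qed.

(** Each chordexc e is recovered in full from each of its two ends, as its
    average over one end vanishes; the rest is the definition of regexc. *)
Lemma resample_drift u : \sum_i (crossX u - avg i crossX u) =
  2 * (linpart u + degpart u + regpart u).
Proof.
have e1 : \sum_i (linpart u - avg i linpart u) = 2 * linpart u.
  rewrite (eq_bigr (fun i => codegree / 4 * \sum_(e in E) (chordexc e u - avg i (chordexc e) u))).
    rewrite -mulr_sumr exchange_big /= /linpart [RHS]mulrCA; congr (_ * _).
    rewrite mulr_sumr; apply: eq_bigr => e /edge_neq ne.
    rewrite (sum_avg_supported _ _ (supported_chordexc (e := e))) /=; last by rewrite inE ne.
    by rewrite !big_cons big_nil avg_chordexc_fst// avg_chordexc_snd//; ring.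
  by move=> i _; rewrite /linpart avgZ avg_sum -mulrBr -sumrB.
have e2 : \sum_i (degpart u - avg i degpart u) = 2 * (degpart u + regpart u).
  rewrite (eq_bigr (fun i => 8^-1 * \sum_(q in quads) (pairexc q u - avg i (pairexc q) u))).
    rewrite -mulr_sumr exchange_big /= /degpart /regpart -mulrDr -big_split /=.
    rewrite [RHS]mulrCA; congr (_ * _); rewrite mulr_sumr; apply: eq_bigr => q qQ.
    have uq : uniq (corners q) by move: qQ; rewrite inE => /and3P[].
    by rewrite (sum_avg_supported _ uq (supported_pairexc (q := q))) /regexc; field.
  by move=> i _; rewrite /degpart avgZ avg_sum -mulrBr -sumrB.
rewrite (eq_bigr (fun i => (linpart u - avg i linpart u) + (degpart u - avg i degpart u))).
  by rewrite big_split /= e1 e2; ring.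
move=> i _; rewrite (eq_avg crossX_decomp) avgDc (avgD _ linpart degpart).
by rewrite crossX_decomp; ring.
Qed.

End Kernels.
End RegularGraph.

(** * Normal approximation for independent positions *)

Section CrossCLT.
Variables (R : realType) (V : finType) (E : {set V * V}) (d : nat).
Hypothesis sE : simple_graph E.
Hypothesis rE : forall v, degree E v = d.
Variable N : nat.
Hypothesis N0 : (0 < N)%N.
Local Notation Om := {ffun V -> 'I_N}.
Local Notation nn := (#|V|%:R : R).
Local Notation dd := (d%:R : R).
Local Notation X := (@crossX R V E N).
Implicit Types (u : Om) (i j : V) (v w : 'I_N).

Let I0 : (0 < #|'I_N|)%N. Proof. by rewrite card_ord. Qed.

Definition increment i v u : R := X u - X (upd u i v).

Lemma increment_bound i v u : `|increment i v u| <= nn * dd ^+ 2 / 2.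
Proof.
rewrite /increment /crossX -mulrBr -sumrB normrM ger0_norm ?invr_ge0//.
have h : `|\sum_(q in quads E) (gcross R q u - gcross R q (upd u i v))| <=
    \sum_(q in quads E) (i \in corners q)%:R.
  apply: le_trans (ler_norm_sum _ _ _) _; apply: ler_sum => q _.
  case: (boolP (i \in _)) => [_|/supported_gcross ->]; last by rewrite subrr normr0.
  have /andP[? ?] := gcross_bound R q u; have /andP[? ?] := gcross_bound R q (upd u i v).
  by rewrite ler_norml; apply/andP; split => /=; lra.
have := sum_quads_at R sE rE i; lra.
Qed.

(** A second difference only sees the pairs of edges having both i and j among
    their corners. *)
Lemma increment_diff i j v w u : i != j ->
  `|increment i v u - increment i v (upd u j w)| <=
  4^-1 * \sum_(q in quads E) (i \in corners q)%:R * (j \in corners q)%:R.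
Proof.
move=> ij; rewrite /increment /crossX -!mulrBr -!sumrB normrM ger0_norm ?invr_ge0//.
have h : `|\sum_(q in quads E) (gcross R q u - gcross R q (upd u i v) -
     (gcross R q (upd u j w) - gcross R q (upd (upd u j w) i v)))| <=
    \sum_(q in quads E) 2 * ((i \in corners q)%:R * (j \in corners q)%:R).
  apply: le_trans (ler_norm_sum _ _ _) _; apply: ler_sum => q _.
  case: (boolP (i \in _)) => [_|iq]; last first.
    by rewrite !(supported_gcross R iq) !subrr normr0 mul0r mulr0.
  case: (boolP (j \in _)) => [_|jq]; last first.
    rewrite upd_comm 1?eq_sym// !(supported_gcross R jq) subrr normr0.
    by rewrite mulr0 mulr0.
  have /andP[? ?] := gcross_bound R q u; have /andP[? ?] := gcross_bound R q (upd u i v).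
  have /andP[? ?] := gcross_bound R q (upd u j w).
  have /andP[? ?] := gcross_bound R q (upd (upd u j w) i v).
  by rewrite ler_norml; apply/andP; split => /=; lra.
rewrite -mulr_sumr in h; lra.
Qed.

Definition sqincr u : R := \sum_i mean (fun v => increment i v u ^+ 2).

(** Changing coordinate j alters the increment at i by the number of pairs of
    edges that contain i and j; summed over i this is four times the number of
    pairs that contain j, hence O(n), while the increments are O(n). *)
Lemma bounded_diff_sqincr : bounded_diff (5 * nn ^+ 2 * dd ^+ 4) sqincr.
Proof.
move=> u j w; rewrite /sqincr -sumrB; apply: le_trans (ler_norm_sum _ _ _) _.
pose b := nn * dd ^+ 2 / 2.
have b0 : 0 <= b by rewrite /b divr_ge0 ?mulr_ge0 ?exprn_ge0.
pose c i : R := \sum_(q in quads E) (i \in corners q)%:R * (j \in corners q)%:R.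
have c0 i : 0 <= c i by apply: sumr_ge0 => q _; rewrite mulr_ge0.
apply: (@le_trans _ _ (\sum_i ((i == j)%:R * b ^+ 2 + b / 2 * c i))).
  apply: ler_sum => i _; rewrite -meanB; apply: le_trans (ler_norm_mean _) _.
  rewrite -[leRHS](mean_cst _ I0); apply: ler_mean => v.
  have h1 := increment_bound i v u; have h2 := increment_bound i v (upd u j w).
  rewrite -/b in h1 h2.
  have [->|ij] := eqVneq i j.
    rewrite mul1r; apply: (@le_trans _ _ (b ^+ 2)); last first.
      by rewrite lerDl mulr_ge0 ?divr_ge0.
    have k1 : 0 <= increment j v u ^+ 2 <= b ^+ 2.
      rewrite sqr_ge0 -real_normK ?num_real// ler_pXn2r ?nnegrE//.
      exact: increment_bound.
    have k2 : 0 <= increment j v (upd u j w) ^+ 2 <= b ^+ 2.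
      rewrite sqr_ge0 -real_normK ?num_real// ler_pXn2r ?nnegrE//.
      exact: increment_bound.
    by move: k1 k2 => /andP[? ?] /andP[? ?]; rewrite ler_norml; apply/andP; split; lra.
  rewrite mul0r add0r subr_sqr normrM.
  have h3 := increment_diff v w u ij; rewrite -/(c i) in h3.
  have h4 : `|increment i v u + increment i v (upd u j w)| <= 2 * b.
    by apply: le_trans (ler_normD _ _) _; lra.
  apply: le_trans (ler_pM _ _ h3 h4) _ => //; lra.
rewrite big_split /= -mulr_suml -mulr_sumr.
have -> : \sum_i (i == j)%:R = 1 :> R.
  rewrite (bigD1 j)//= eqxx big1 ?addr0// => i /negbTE -> //.
have -> : \sum_i c i = 4 * \sum_(q in quads E) (j \in corners q)%:R.
  rewrite /c exchange_big /= mulr_sumr; apply: eq_bigr => q qQ.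
  by rewrite -mulr_suml (sum_corners R qQ).
have := sum_quads_at R sE rE j; set s := \sum_(q in _) _ => hs.
have : b / 2 * (4 * s) <= b / 2 * (4 * (4 * nn * dd ^+ 2)).
  by rewrite ler_wpM2l ?divr_ge0// ler_pM2l.
have : 0 <= nn ^+ 2 * dd ^+ 4 by rewrite mulr_ge0 ?exprn_ge0.
have -> : b / 2 * (4 * (4 * nn * dd ^+ 2)) = 4 * (nn ^+ 2 * dd ^+ 4) by rewrite /b; field.
have -> : b ^+ 2 = (nn ^+ 2 * dd ^+ 4) / 4 by rewrite /b; field.
lra.
Qed.

Variables (mu sigma kappa t B : R).
Hypothesis kappa0 : 0 < kappa.
Hypothesis t0 : 0 < t.
Hypothesis t1 : t <= 1.
Hypothesis tn : t ^+ 2 * nn = 1.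
Hypothesis sigmaE : sigma = kappa * nn / t.
Hypothesis cmu : `|crossmean R V d N - mu| <= dd ^+ 2 * nn.
Hypothesis B0 : 0 <= B.
Hypothesis var1 :
  `|mean (fun u : Om => linpart R E d u ^+ 2) / sigma ^+ 2 - 1| <= B * t.

Definition clt_const : R :=
  let a := dd ^+ 2 / kappa in
  2 * (B + 29 * (1 + B) * a + 120 * a ^+ 2 + 5 / 4 * a ^+ 2)
  + mills_bound R * (21 * a)
  + (a / 2) ^+ 3 / 4 * (mills_bound R + 2 * (1 + B + 5 * a) + a)
  + 4 * a * (1 + B + 26 * a).

(** Here t stands for 1 / sqrt n.  With a = d ^ 2 / kappa one step of the pair
    moves W by at most a t / 2, and the rates of the four error terms of
    [stein_exchangeable] are all of order t. *)
Lemma crossX_clt z :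
  `|mean (fun u : Om => ((X u - mu) / sigma <= z)%R%:R) - Phi z| <= clt_const * t.
Proof.
have nn0 : 0 < nn.
  rewrite lt_neqAle ler0n andbT eq_sym; apply/eqP => nn0.
  by move: tn; rewrite nn0 mulr0 => /eqP; rewrite eq_sym oner_eq0.
have V0 : (0 < #|V|)%N by rewrite ltr0n in nn0.
have s0 : 0 < sigma by rewrite sigmaE divr_gt0 ?mulr_gt0.
have sn0 : sigma != 0 by rewrite gt_eqF.
have nn_neq : nn != 0 by rewrite gt_eqF.
have t_neq : t != 0 by rewrite gt_eqF.
have k_neq : kappa != 0 by rewrite gt_eqF.
have nt : nn = t ^- 2 by apply: (mulfI (expf_neq0 2 t_neq)); rewrite tn divff ?expf_neq0.
have ns : nn / sigma = t / kappa by rewrite sigmaE; field; apply/and3P.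
pose a := dd ^+ 2 / kappa.
have a0 : 0 <= a by rewrite divr_ge0 ?exprn_ge0 ?(ltW kappa0).
have an : dd ^+ 2 * nn / sigma = a * t by rewrite -mulrA ns /a; ring.
have at0 : 0 <= a * t by rewrite mulr_ge0 ?(ltW t0).
have ata : a * t <= a by rewrite ler_piMr.
set W := fun u : Om => (X u - mu) / sigma.
pose Wbar (s : Om * V * 'I_N) := W s.1.1.
pose lin u := linpart R E d u; pose deg u := degpart R E u.
pose reg u := regpart R E u.
pose c := crossmean R V d N - mu.
have Wdec u : W u = (lin u + (deg u + c)) / sigma.
  by rewrite /W (crossX_decomp R sE rE) /lin /deg /c; field.
pose rho u := (reg u - c) / sigma.
have Wrho u : W u + rho u = (lin u + (deg u + reg u)) / sigma.
  by rewrite Wdec /rho; field.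
pose F u := sqincr u / (4 * sigma ^+ 2).
pose lam := 2 / nn.
have lam0 : 0 < lam by rewrite divr_gt0.
have S0 : (0 < #|{: Om * V * 'I_N}|)%N.
  by rewrite !card_prod !muln_gt0 (Om_card0 V I0) V0 card_ord.
have step s : `|Wbar s - Wbar (resample s)| <= a * t / 2.
  rewrite /Wbar /W -mulrBl opprB addrA subrK normrM (gtr0_norm (_ : 0 < sigma^-1)) ?invr_gt0//.
  rewrite ler_pdivrMr//; apply: le_trans (increment_bound _ _ _) _.
  by rewrite -an le_eqVlt; apply/orP; left; apply/eqP; field.
(* The drift of one resampling is the average over i of X u - avg i X u. *)
have regr f : mean (fun s => (Wbar s - Wbar (resample s)) * f (Wbar s)) =
    lam * mean (fun s => (Wbar s + rho s.1.1) * f (Wbar s)).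
  rewrite (mean_resample (fun u i v => (W u - W (upd u i v)) * f (W u))).
  rewrite (mean_resample_fst I0 (fun u => (W u + rho u) * f (W u)) V0) -meanZ.
  apply: eq_mean => u.
  rewrite (eq_bigr (fun i => (f (W u) / sigma) * (X u - avg i X u))) => [|i _].
    by rewrite -mulr_sumr (resample_drift R sE rE N0) Wrho /lam /lin /deg /reg; field; apply/andP.
  rewrite /avg -{1}[X u](mean_cst (X u) I0) -meanB -meanZ; apply: eq_mean => v.
  by rewrite /W; field.
have cond f : mean (fun s => (Wbar s - Wbar (resample s)) ^+ 2 * f (Wbar s)) =
    2 * lam * mean (fun s => F s.1.1 * f (Wbar s)).
  rewrite (mean_resample (fun u i v => (W u - W (upd u i v)) ^+ 2 * f (W u))).
  rewrite (mean_resample_fst I0 (fun u => F u * f (W u)) V0) -meanZ.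
  apply: eq_mean => u.
  rewrite (eq_bigr (fun i => (f (W u) / sigma ^+ 2) *
      mean (fun v => increment i v u ^+ 2))) => [|i _].
    by rewrite -mulr_sumr -/(sqincr u) /F /lam; field; apply/andP.
  by rewrite -meanZ; apply: eq_mean => v; rewrite /W /increment; field.
have lin2 : mean (fun u => lin u ^+ 2) <= ((1 + B) * sigma) ^+ 2.
  move: var1; rewrite ler_norml => /andP[_ h].
  have h1 : mean (fun u => lin u ^+ 2) / sigma ^+ 2 <= 1 + B.
    have : B * t <= B by rewrite ler_piMr.
    rewrite -/(lin _) in h; lra.
  rewrite ler_pdivrMr ?exprn_gt0// in h1; apply: le_trans h1 _.
  rewrite exprMn ler_wpM2r ?sqr_ge0// expr2 ler_peMr ?addr_ge0//.
  by rewrite lerDl.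
have dn0 : 0 <= dd ^+ 2 * nn by rewrite mulr_ge0 ?exprn_ge0 ?(ltW nn0).
have deg2 : mean (fun u => deg u ^+ 2) <= (4 * dd ^+ 2 * nn) ^+ 2 by exact: mean_degpart_sqr.
have reg2 : mean (fun u => reg u ^+ 2) <= (20 * dd ^+ 2 * nn) ^+ 2 by exact: mean_regpart_sqr.
have c2 : mean (fun u : Om => c ^+ 2) <= (dd ^+ 2 * nn) ^+ 2.
  rewrite mean_cst ?Om_card0// -real_normK ?num_real//.
  by rewrite ler_pXn2r ?nnegrE.
have degc2 : mean (fun u => (deg u + c) ^+ 2) <= (5 * dd ^+ 2 * nn) ^+ 2.
  have -> : 5 * dd ^+ 2 * nn = 4 * dd ^+ 2 * nn + dd ^+ 2 * nn by ring.
  by apply: (mean_sqrD (G := fun=> c)) => //; rewrite -mulrA mulr_ge0.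
have degreg2 : mean (fun u => (deg u + reg u) ^+ 2) <= (24 * dd ^+ 2 * nn) ^+ 2.
  have -> : 24 * dd ^+ 2 * nn = 4 * dd ^+ 2 * nn + 20 * dd ^+ 2 * nn by ring.
  by apply: mean_sqrD => //; rewrite -mulrA mulr_ge0.
have Om0 := Om_card0 V I0.
have scale (G : Om -> R) g : 0 <= g -> mean (fun u => G u ^+ 2) <= g ^+ 2 ->
    mean (fun u => `|G u / sigma|) <= g / sigma.
  move=> g0 hG; apply: mean_abs_le => //; first by rewrite divr_ge0 ?(ltW s0).
  rewrite (eq_mean (G := fun u => sigma ^- 2 * G u ^+ 2)) => [|u]; last first.
    by rewrite exprMn exprVn mulrC.
  by rewrite meanZ mulrC expr_div_n ler_wpM2r// invr_ge0 sqr_ge0.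
have EW : mean (fun s => `|Wbar s|) <= 1 + B + 5 * a.
  rewrite (mean_resample_fst I0 (fun u => `|W u|) V0) (eq_mean (G := fun u =>
    `|(lin u + (deg u + c)) / sigma|)) => [|u]; last by rewrite Wdec.
  have := scale (fun u => lin u + (deg u + c)) ((1 + B) * sigma + 5 * dd ^+ 2 * nn).
  have -> : ((1 + B) * sigma + 5 * dd ^+ 2 * nn) / sigma = 1 + B + 5 * (a * t).
    by rewrite -an; field.
  move=> h; apply: le_trans (h _ _) _.
  - by rewrite addr_ge0 ?mulr_ge0 ?addr_ge0 ?exprn_ge0 ?(ltW s0) ?(ltW nn0).
  - apply: mean_sqrD => //; first by rewrite mulr_ge0 ?addr_ge0 ?(ltW s0).
  - lra.
have Erho : mean (fun s : Om * V * 'I_N => `|rho s.1.1|) <= 21 * a * t.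
  rewrite (mean_resample_fst I0 (fun u => `|rho u|) V0).
  apply: le_trans (scale (fun u => reg u - c) (20 * dd ^+ 2 * nn + dd ^+ 2 * nn) _ _) _.
  - by rewrite addr_ge0// -mulrA mulr_ge0.
  - apply: (mean_sqrD (G := fun=> - c)) => //.
    by rewrite (eq_mean (G := fun=> c ^+ 2)) => [//|u]; rewrite sqrrN.
  - by rewrite -[21 * a * t]mulrA -an le_eqVlt; apply/orP; left; apply/eqP; field.
(* Testing the pair against the identity expresses mean F as the mean of
   (W + rho) * W, whose leading part is the variance of lin / sigma. *)
have EF : `|mean F - 1| <= (B + 29 * (1 + B) * a + 120 * a ^+ 2) * t.
  have FE : mean F = mean (fun u => lin u ^+ 2) / sigma ^+ 2
      + (mean (fun u => lin u * ((deg u + reg u) + (deg u + c)))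
      + mean (fun u => (deg u + reg u) * (deg u + c))) / sigma ^+ 2.
    have := exchangeable_mean (@resampleK V 'I_N) regr id.
    have := cond (fun=> 1).
    rewrite (eq_mean (G := fun s => (Wbar s - Wbar (resample s)) ^+ 2)); last first.
      by move=> s; rewrite mulr1.
    rewrite [X in _ = _ * X](eq_mean (G := fun s => F s.1.1)); last first.
      by move=> s; rewrite mulr1.
    rewrite (mean_resample_fst I0 F V0) => e1 e2.
    have {}e2 : mean F = mean (fun s => (Wbar s + rho s.1.1) * Wbar s).
      apply: (@mulfI _ (2 * lam)); first by rewrite mulf_neq0 ?gt_eqF.
      rewrite -e1 -e2; apply: eq_mean => s; ring.
    rewrite e2 (mean_resample_fst I0 (fun u => (W u + rho u) * W u) V0).
    rewrite -mulrDl -!meanD mulrC -meanZ; apply: eq_mean => u.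
    by rewrite Wrho Wdec; field.
  have h1 : `|mean (fun u => lin u * ((deg u + reg u) + (deg u + c)))| <=
      (1 + B) * sigma * (24 * dd ^+ 2 * nn + 5 * dd ^+ 2 * nn).
    apply: mean_holder => //.
    - by rewrite mulr_ge0 ?addr_ge0 ?(ltW s0).
    - by apply: mean_sqrD => //; rewrite -mulrA mulr_ge0.
  have h2 : `|mean (fun u => (deg u + reg u) * (deg u + c))| <=
      24 * dd ^+ 2 * nn * (5 * dd ^+ 2 * nn).
    by apply: mean_holder => //; rewrite -mulrA mulr_ge0.
  rewrite FE.
  set m0 := mean (fun u => lin u ^+ 2) / _.
  set m1 := mean _ in h1 *; set m2 := mean _ in h2 *.
  have -> : m0 + (m1 + m2) / sigma ^+ 2 - 1 = (m0 - 1) + (m1 + m2) / sigma ^+ 2 by ring.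
  apply: le_trans (ler_normD _ _) _.
  have h3 : `|(m1 + m2) / sigma ^+ 2| <= 29 * (1 + B) * (a * t) + 120 * (a * t) ^+ 2.
    rewrite normrM (ger0_norm (_ : 0 <= sigma ^- 2)) ?invr_ge0 ?sqr_ge0//.
    rewrite ler_pdivrMr ?exprn_gt0//; apply: le_trans (ler_normD _ _) _.
    apply: le_trans (lerD h1 h2) _; rewrite -an le_eqVlt; apply/orP; left; apply/eqP.
    by field.
  have h4 : (a * t) ^+ 2 <= a ^+ 2 * t.
    by rewrite exprMn ler_wpM2l ?sqr_ge0// expr2 ler_piMr ?(ltW t0).
  have h5 := var1; rewrite -/(lin _) in h5.
  have {}h5 : `|m0 - 1| <= B * t by [].
  lra.
(* Efron-Stein gives sqrt n * O(n ^ 2) / sigma ^ 2, of order 1 / sqrt n. *)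
have VF : mean (fun u => `|F u - mean F|) <= 5 / 4 * a ^+ 2 * t.
  apply: mean_abs_le => //; first by rewrite mulr_ge0 ?(ltW t0)// mulr_ge0 ?sqr_ge0.
  have bF : bounded_diff (5 * nn ^+ 2 * dd ^+ 4 / (4 * sigma ^+ 2)) F.
    move=> u i v; rewrite /F -mulrBl normrM.
    have i0 : 0 <= (4 * sigma ^+ 2)^-1 by rewrite invr_ge0 mulr_ge0 ?sqr_ge0.
    by rewrite (ger0_norm i0) ler_wpM2r//; exact: bounded_diff_sqincr.
  apply: le_trans (efron_stein I0 bF) _.
  rewrite le_eqVlt; apply/orP; left; apply/eqP.
  have -> : 5 * nn ^+ 2 * dd ^+ 4 / (4 * sigma ^+ 2) = 5 / 4 * (a * t) ^+ 2.
    by rewrite -an; field.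
  by rewrite nt; field.
have E1F : mean (fun s : Om * V * 'I_N => `|1 - F s.1.1|) <=
    (B + 29 * (1 + B) * a + 120 * a ^+ 2 + 5 / 4 * a ^+ 2) * t.
  rewrite (mean_resample_fst I0 (fun u => `|1 - F u|) V0).
  apply: (@le_trans _ _ (mean (fun u => `|mean F - 1| + `|F u - mean F|))).
    apply: ler_mean => u; rewrite -(normrN (mean F - 1)) -(normrN (F u - _)).
    by apply: le_trans (ler_normD _ _); rewrite le_eqVlt; apply/orP; left; apply/eqP;
      congr `|_|; ring.
  rewrite meanD mean_cst//; lra.
have := stein_exchangeable S0 (@resampleK V 'I_N) lam0 step regr cond z.
rewrite (mean_resample_fst I0 (fun u => (W u <= z)%R%:R) V0) => /le_trans; apply.
have mb0 : 0 <= mills_bound R by apply: le_trans (mills_ge0 0) (mills_le _).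
have EW0 : 0 <= mean (fun s => `|Wbar s|) by apply: mean_ge0.
move: E1F EW Erho EW0; set e1 := mean _; set e2 := mean _; set e3 := mean _.
move=> h1 h2 h3 h4.
have -> : (a * t / 2) ^+ 3 / (2 * lam) = (a / 2) ^+ 3 / 4 * t.
  by rewrite /lam nt; field.
have c1 : mills_bound R * e3 <= mills_bound R * (21 * a) * t.
  by rewrite -mulrA ler_wpM2l.
have c3 : (a / 2) ^+ 3 / 4 * t * (mills_bound R + 2 * e2 + 2 * (a * t / 2)) <=
    (a / 2) ^+ 3 / 4 * (mills_bound R + 2 * (1 + B + 5 * a) + a) * t.
  rewrite [leRHS]mulrAC; apply: ler_wpM2l; last by lra.
  have h5 : 0 <= (a / 2) ^+ 3 by apply: exprn_ge0; exact: divr_ge0.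
  by apply: mulr_ge0 (ltW t0); exact: divr_ge0.
have c4 : 8 * (a * t / 2) * (e2 + e3) <= 4 * a * (1 + B + 26 * a) * t.
  have -> : 8 * (a * t / 2) * (e2 + e3) = 4 * a * t * (e2 + e3) by field.
  rewrite [leRHS]mulrAC; apply: ler_wpM2l; last by lra.
  by rewrite mulr_ge0 ?(ltW t0)// mulr_ge0.
rewrite /clt_const -/a; lra.
Qed.

End CrossCLT.

(** * From independent positions to random permutations *)

Definition alternating (a b c d : nat) : bool := [&& d < b, b < c & c < a]%N.

(** Two interlaced pairs determine exactly one way of naming their ends so that
    they alternate in decreasing order a, c, b, d. *)
Lemma interlace_alternating (a b c d : nat) : uniq [:: a; b; c; d] ->
  nat_of_bool (interlace a b c d) =
  (alternating a b c d + alternating b a c d +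
   (alternating a b d c + alternating b a d c) +
   (alternating c d a b + alternating d c a b +
   (alternating c d b a + alternating d c b a)))%N.
Proof.
rewrite /= !inE !negb_or => /and4P[/and3P[ab ac ad] /andP[bc bd] cd _].
rewrite /interlace /arc /alternating.
case: (ltngtP a c) ac => // h1 _; case: (ltngtP b c) bc => // h2 _;
case: (ltngtP a d) ad => // h3 _; case: (ltngtP b d) bd => // h4 _;
case: (ltngtP a b) ab => // h5 _; case: (ltngtP c d) cd => // h6 _ /=; lia.
Qed.

Section CrossingCount.
Variables (R : realType) (n : nat) (E : {set 'I_n * 'I_n}).
Hypothesis sE : simple_graph E.
Local Notation V := 'I_n.
Local Notation Q := ((V * V) * (V * V))%type.

Lemma sum_quads_involution (g : Q -> Q) (F : Q -> R) : involutive g ->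
  (forall q, (g q \in quads E) = (q \in quads E)) ->
  \sum_(q in quads E) F (g q) = \sum_(q in quads E) F q.
Proof.
move=> gK gQ; rewrite [RHS](reindex_inj (can_inj gK)) /=.
by apply: eq_bigl => q; rewrite gQ.
Qed.

Let g1 (q : Q) := (swap q.1, q.2).
Let g2 (q : Q) := (q.1, swap q.2).
Let g3 (q : Q) := (q.2, q.1).

Let sum_g1 (F : Q -> R) : \sum_(q in quads E) F (g1 q) = \sum_(q in quads E) F q.
Proof.
apply: sum_quads_involution => [[[a b] e]//|[[a b] [c e]]].
rewrite !inE /= (edge_swap sE); congr [&& _, _ & _].
apply: (@perm_uniq _ [:: b; a; c; e] [:: a; b; c; e]).
exact/permPl/(perm_catCA [:: b] [:: a] [:: c; e]).
Qed.

Let sum_g3 (F : Q -> R) : \sum_(q in quads E) F (g3 q) = \sum_(q in quads E) F q.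
Proof.
apply: sum_quads_involution => [[e f]//|[e f]].
by rewrite !inE (uniq_corners_swap e f) /g3 /= andbCA.
Qed.

Let sum_g2 (F : Q -> R) : \sum_(q in quads E) F (g2 q) = \sum_(q in quads E) F q.
Proof.
by rewrite -sum_g3 -[RHS]sum_g3 -[RHS]sum_g1; apply: eq_bigr => -[e f].
Qed.

Definition qalternating (x : V -> nat) (q : Q) : bool :=
  alternating (x q.1.1) (x q.1.2) (x q.2.1) (x q.2.2).

(** The eight terms of [interlace_alternating] are exchanged by reversing either
    edge and by exchanging the two edges. *)
Lemma sum_interlace (x : V -> nat) : injective x ->
  \sum_(q in quads E) (interlace (x q.1.1) (x q.1.2) (x q.2.1) (x q.2.2))%:R =
  8 * \sum_(q in quads E) (qalternating x q)%:R :> R.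
Proof.
move=> xI; pose P q : R := (qalternating x q)%:R.
rewrite (eq_bigr (fun q => P q + P (g1 q) + (P (g2 q) + P (g1 (g2 q))) +
   (P (g3 q) + P (g1 (g3 q)) + (P (g2 (g3 q)) + P (g1 (g2 (g3 q))))))).
  rewrite !big_split /= !sum_g1 !sum_g2 !sum_g3.
  rewrite (sum_g2 (fun q => P (g1 q))) (sum_g3 (fun q => P (g1 q))).
  rewrite (sum_g3 (fun q => P (g2 q))) (sum_g3 (fun q => P (g1 (g2 q)))).
  rewrite (sum_g2 (fun q => P (g1 q))) !sum_g1 !sum_g2.
  ring.
move=> -[[a b] [c e]]; rewrite inE /= => /and3P[_ _ uq].
rewrite interlace_alternating ?natrD//.
by rewrite -[[:: _; _; _; _]]/(map x [:: a; b; c; e]) map_inj_uniq.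
Qed.

Lemma sum_qalternating (p : {perm V}) :
  \sum_(q in quads E) (qalternating (fun i => p i) q)%:R = (crossings E p)%:R :> R.
Proof.
rewrite /crossings -sum1dep_card natr_sum.
pose h (q : Q) : V * V * V * V := (q.1.1, q.1.2, q.2.1, q.2.2).
pose h' (q : V * V * V * V) : Q := ((q.1.1.1, q.1.1.2), (q.1.2, q.2)).
rewrite [RHS](reindex h) /=; last first.
  by exists h' => [[[a b] [c e]]|[[[a b] c] e]].
rewrite big_mkcond [RHS]big_mkcond /=; apply: eq_bigr => -[[a b] [c e]] _.
rewrite inE /= /qalternating /alternating /=.
case: ((a, b) \in E) => //=; case: ((c, e) \in E) => //=.
case: ifPn => uq.
  by rewrite -andbA; case: ifP.
rewrite -andbA; case: ifPn => // /and3P[h1 h2 h3]; case/negP: uq.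
have xI : injective (fun i => val (p i)) by apply: inj_comp val_inj (@perm_inj _ p).
have : uniq [seq val (p i) | i <- [:: a; b; c; e]] by rewrite /= !inE; lia.
by rewrite (map_inj_uniq xI).
Qed.

Lemma crossX_perm (N : nat) (u : {ffun V -> 'I_N}) (p : {perm V}) : injective u ->
  (forall i j, (p i < p j)%N = (u i < u j)%N) ->
  crossX R E u = (crossings E p)%:R.
Proof.
move=> uI up; rewrite /crossX /gcross.
have xI : injective (fun i => val (u i)) by apply: inj_comp val_inj uI.
rewrite (sum_interlace xI) mulKf// -sum_qalternating.
by apply: eq_bigr => q _; rewrite /qalternating /alternating !up.
Qed.

End CrossingCount.

(** The rank of i is the number of j placed strictly before i. *)
Lemma rank_perm (n N : nat) (u : {ffun 'I_n -> 'I_N}) : injective u ->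
  exists p : {perm 'I_n}, forall i j, (p i < p j)%N = (u i < u j)%N.
Proof.
move=> uI; pose r i := #|[set j | (u j < u i)%N]%SET|.
have rmono i j : (u i < u j)%N -> (r i < r j)%N.
  move=> ij; apply: proper_card; apply/properP; split.
    by apply/fintype.subsetP => k; rewrite !inE => /ltn_trans; apply.
  by exists i; rewrite !inE ?ltnn.
have rn i : (r i < n)%N.
  rewrite -[X in (_ < X)%N]card_ord -cardsT; apply: proper_card; apply/properP.
  by split; [apply/fintype.subsetP => k _; rewrite inE|exists i; rewrite !inE ?ltnn].
have rE i j : (r i < r j)%N = (u i < u j)%N.
  case: (ltngtP (u i) (u j)) => [/rmono//|/rmono h|/val_inj/uI ->].
    by apply/negbTE; rewrite -leqNgt ltnW.
  by rewrite ltnn.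
have rI : injective (fun i => Ordinal (rn i)).
  move=> i j /(congr1 val) /= e; apply: uI; apply: val_inj.
  by case: (ltngtP (u i) (u j)) => // /rmono; rewrite e ltnn.
by exists (perm rI) => i j; rewrite !permE /= rE.
Qed.

Section Transfer.
Variables (R : realType) (n N : nat) (E : {set 'I_n * 'I_n}).
Hypothesis sE : simple_graph E.
Hypothesis N0 : (0 < N)%N.
Local Notation Om := {ffun 'I_n -> 'I_N}.

Let I0 : (0 < #|'I_N|)%N. Proof. by rewrite card_ord. Qed.
Let Om0 := Om_card0 'I_n I0.

Definition relabel (s : {perm 'I_n}) (u : Om) : Om := [ffun i => u (s i)].

Lemma mean_relabel s (F : Om -> R) : mean (fun u => F (relabel s u)) = mean F.
Proof.
rewrite /mean [in RHS](reindex (relabel s))//; exists (relabel s^-1%g) => u _;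
by apply/ffunP => i; rewrite !ffunE ?permK ?permKV.
Qed.

Let perm0 : (0 < #|{perm 'I_n}|)%N.
Proof. by apply/card_gt0P; exists 1%g. Qed.

(** Relabelling by s composes the rank permutation of u with s, and a
    translate of a uniform permutation is uniform. *)
Lemma mean_crossX_relabel (f : R -> R) (u : Om) : injective u ->
  mean (fun s => f (crossX R E (relabel s u))) =
  mean (fun p => f (crossings E p)%:R).
Proof.
move=> uI; have [p up] := rank_perm uI.
rewrite (eq_mean (G := fun s : {perm 'I_n} => f (crossings E (s * p)%g)%:R)).
  rewrite /mean [in RHS](reindex (fun s => (s * p)%g))//.
  by exists (fun s => (s * p^-1)%g) => s _; rewrite ?mulgK ?mulgKV.
move=> s; rewrite (crossX_perm R sE (p := (s * p)%g))//.
  by move=> i j; rewrite !ffunE => /uI /perm_inj.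
by move=> i j; rewrite !permM !ffunE up.
Qed.

Lemma mean_collision (i j : 'I_n) : i != j ->
  mean (fun u : Om => (u i == u j)%:R) = N%:R^-1 :> R.
Proof.
move=> ij; rewrite -(mean_avg I0 i).
rewrite (eq_mean (G := fun=> N%:R^-1)) ?mean_cst// => u.
rewrite /avg (eq_mean (G := fun v => (v == u j)%:R)) => [|v]; last first.
  by rewrite upd_same upd_other// eq_sym.
rewrite /mean card_ord (bigD1 (u j))//= eqxx big1 ?addr0 ?mul1r// => v.
by move=> /negbTE ->.
Qed.

Lemma mean_not_injective :
  mean (fun u : Om => (~~ injectiveb u)%:R) <= n%:R ^+ 2 / N%:R :> R.
Proof.
apply: (@le_trans _ _ (mean (fun u : Om => \sum_i \sum_(j | i != j) ((u i == u j)%:R : R)))).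
  apply: ler_mean => u.
  have s0 : 0 <= \sum_i \sum_(j | i != j) ((u i == u j)%:R : R).
    by apply: sumr_ge0 => i _; apply: sumr_ge0.
  case: (boolP (injectiveb u)) => //= /injectivePn[i [j ij uij]].
  rewrite (bigD1 i)//= (bigD1 j)//= uij eqxx -addrA lerDl addr_ge0//.
    by apply: sumr_ge0.
  by apply: sumr_ge0 => k _; apply: sumr_ge0.
rewrite mean_sum; apply: (@le_trans _ _ (\sum_(i < n) n%:R / N%:R)).
  apply: ler_sum => i _; rewrite mean_sum.
  rewrite (eq_bigr (fun=> N%:R^-1)) => [|j ij]; last exact: mean_collision.
  apply: (@le_trans _ _ (\sum_(j < n) N%:R^-1)).
    by rewrite [leRHS](bigID (fun j => i != j)) /= lerDl sumr_ge0// => j _.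
  by rewrite sumr_const card_ord [leRHS]mulr_natl.
by rewrite sumr_const card_ord -[leLHS]mulr_natl expr2 mulrA.
Qed.

(** Relabelling preserves the uniform law of the positions, so one may average
    over all relabellings first; the configurations with a collision are
    the only ones for which this average differs from the one over
    permutations. *)
Lemma mean_crossX_crossings (f : R -> R) : (forall x, 0 <= f x <= 1) ->
  `|mean (fun u : Om => f (crossX R E u)) - mean (fun p => f (crossings E p)%:R)|
  <= n%:R ^+ 2 / N%:R.
Proof.
move=> f01; apply: le_trans mean_not_injective.
set A := mean (fun p : {perm _} => _).
have -> : mean (fun u : Om => f (crossX R E u)) =
    mean (fun u : Om => mean (fun s => f (crossX R E (relabel s u)))).
  rewrite mean_swap -[LHS](mean_cst _ perm0); apply: eq_mean => s.
  by rewrite (mean_relabel s (fun u => f (crossX R E u))).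
rewrite -{1}[A](mean_cst A Om0) -meanB; apply: le_trans (ler_norm_mean _) _.
have bnd (T : finType) (g : T -> R) : (0 < #|T|)%N ->
    (forall x, 0 <= g x <= 1) -> 0 <= mean g <= 1.
  move=> T0 g01; rewrite mean_ge0 => [|x]; last by case/andP: (g01 x).
  by rewrite -[X in _ <= X](mean_cst 1 T0) ler_mean// => x; case/andP: (g01 x).
apply: ler_mean => u; case: (boolP (injectiveb u)) => /= [/injectiveP uI|_].
  by rewrite mean_crossX_relabel// subrr normr0.
have /andP[a0 a1] : 0 <= A <= 1 by apply: bnd => // p.
have /andP[b0 b1] : 0 <= mean (fun s => f (crossX R E (relabel s u))) <= 1.
  by apply: bnd => // p.
by rewrite ler_norml; apply/andP; split; lra.
Qed.

End Transfer.

(** * Normal approximation for a fixed regular graph *)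

Section RegularCLT.
Variables (R : realType) (n d : nat).
Hypothesis hd : (1 <= d)%N.
Hypothesis hn : (2 * d < n)%N.

Local Notation nn := (n%:R : R).
Local Notation dd := (d%:R : R).
Local Notation mu := (crossing_mean R n d).
Local Notation sigma := (crossing_sd R n d).

Definition sd_factor : R := Num.sqrt (dd ^+ 3 / 360).

Definition regular_const : R := clt_const d sd_factor 29 + 1.

Let dd1 : 1 <= dd. Proof. by rewrite ler1n. Qed.
Let nd : 2 * dd + 1 <= nn.
Proof. by rewrite -[2]/(2%:R) -natrM natr1 ler_nat. Qed.

Let nn0 : 0 < nn. Proof. by have := nd; have := dd1; lra. Qed.
Let nn1 : 1 <= nn. Proof. by have := nd; have := dd1; lra. Qed.

Lemma sd_factor_gt0 : 0 < sd_factor.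
Proof.
have h : 0 < 360 :> R by rewrite ltr0n.
by rewrite sqrtr_gt0; apply: divr_gt0 h; apply: exprn_gt0; exact: lt_le_trans dd1.
Qed.

Lemma crossing_sdE : sigma = sd_factor * nn / (Num.sqrt nn)^-1.
Proof.
have s0 : Num.sqrt nn ^+ 2 = nn by rewrite sqr_sqrtr// ltW.
rewrite /crossing_sd /sd_factor invrK -mulrA.
have -> : nn * Num.sqrt nn = Num.sqrt (nn ^+ 3).
  rewrite exprS sqrtrM ?(ltW nn0)// sqrtr_sqr ger0_norm ?(ltW nn0)//.
  by rewrite mulrC.
rewrite -sqrtrM; last by apply: divr_ge0; [exact: exprn_ge0|exact: ler0n].
congr Num.sqrt.
by rewrite /edge_number natrM; field.
Qed.

Lemma crossing_sd_gt0 : 0 < sigma.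
Proof.
by rewrite crossing_sdE divr_gt0 ?mulr_gt0 ?sd_factor_gt0 ?invr_gt0 ?sqrtr_gt0.
Qed.

Lemma crossing_sd_sqr : sigma ^+ 2 = (nn * dd) ^+ 3 / 360.
Proof.
rewrite /crossing_sd sqr_sqrtr; first by rewrite /edge_number natrM; field.
by rewrite divr_ge0 ?exprn_ge0// /edge_number divr_ge0.
Qed.

Section FixedGraph.
Variable E : {set 'I_n * 'I_n}.
Hypothesis sE : simple_graph E.
Hypothesis rE : forall v, degree E v = d.

Lemma regular_clt z :
  `|mean (fun p => (((crossings E p)%:R - mu) / sigma <= z)%R%:R) - Phi z| <=
  regular_const / Num.sqrt nn.
Proof.
have nd1 := nd; have nn01 := nn0; have nn11 := nn1; have dd11 := dd1.
(* With N = n ^ 3 collisions and discretisation cost at most O(1 / n). *)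
pose N := (n ^ 3)%N.
have n0 : (0 < n)%N by apply: leq_ltn_trans hn.
have N0 : (0 < N)%N by rewrite expn_gt0 n0.
have NE : N%:R = nn ^+ 3 :> R by rewrite natrX.
pose t := (Num.sqrt nn)^-1.
have sq0 : 0 < Num.sqrt nn by rewrite sqrtr_gt0.
have t0 : 0 < t by rewrite invr_gt0.
have tn : t ^+ 2 * (#|'I_n|%:R : R) = 1.
  by rewrite card_ord /t exprVn sqr_sqrtr ?(ltW nn0)// mulVf// gt_eqF.
have tsq : nn^-1 = t ^+ 2.
  by rewrite /t exprVn sqr_sqrtr ?(ltW nn0).
have t1 : t <= 1.
  by rewrite invf_le1// -{1}(sqrtr1 R) ler_wsqrtr.
have tt : nn^-1 <= t by rewrite tsq expr2 ler_piMr ?(ltW t0).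
have nneq : nn != 0 by rewrite gt_eqF.
have dneq : dd != 0 by rewrite gt_eqF// (lt_le_trans ltr01).
have sE' : sigma = sd_factor * (#|'I_n|%:R : R) / t by rewrite card_ord crossing_sdE.
have cdE : codegree R 'I_n d = nn * dd - 4 * dd + 2 by rewrite /codegree card_ord.
have cd0 : 0 <= codegree R 'I_n d <= nn * dd.
  rewrite cdE; apply/andP; split; last by lra.
  by nra.
have [c0 c1] := andP cd0.
have N2 : N%:R ^- 2 <= nn^-1 :> R.
  rewrite NE -exprM lef_pV2 ?posrE ?exprn_gt0//.
  by rewrite -[leLHS]expr1 ler_weXn2l.
have N2' : 0 <= N%:R ^- 2 :> R by rewrite invr_ge0 exprn_ge0.
have N1 : nn^-1 <= 1 by rewrite invf_le1.
have cmu : `|crossmean R 'I_n d N - mu| <= dd ^+ 2 * (#|'I_n|%:R : R).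
  have -> : crossmean R 'I_n d N - mu =
     - (codegree R 'I_n d * (nn * dd) / 24 * N%:R ^- 2).
    rewrite /crossmean /crossing_mean /edge_number /meanprob card_ord cdE natrM.
    set N2v := N%:R ^- 2; by field.
  have nd0 : 0 <= nn * dd by rewrite mulr_ge0.
  rewrite normrN ger0_norm; last by rewrite !mulr_ge0.
  rewrite card_ord; apply: (@le_trans _ _ ((nn * dd) * (nn * dd) / 24 * nn^-1)).
    by rewrite ler_pM ?ler_wpM2r ?mulr_ge0.
  have -> : nn * dd * (nn * dd) / 24 * nn^-1 = dd ^+ 2 * nn / 24 by field.
  by rewrite ler_pdivrMr// ler_peMr ?mulr_ge0 ?exprn_ge0// ler1n.
(* Of the constant 29, the codegree, which differs from n d by at most 4 d,
   accounts for 8, and varprob for 21. *)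
have var1 : `|mean (fun u : {ffun 'I_n -> 'I_N} => linpart R E d u ^+ 2) / sigma ^+ 2 - 1|
    <= 29 * t.
  rewrite (mean_linpart_sqr R sE rE N0) crossing_sd_sqr card_ord.
  pose y := codegree R 'I_n d / (nn * dd).
  pose e := 45 * varprob R N - 1.
  have -> : codegree R 'I_n d ^+ 2 * (nn * dd) * varprob R N / 8 / ((nn * dd) ^+ 3 / 360) - 1
     = (y ^+ 2 - 1) + y ^+ 2 * e.
    by rewrite /y /e; field; apply/andP.
  have nd0 : 0 < nn * dd by rewrite mulr_gt0// (lt_le_trans ltr01).
  have y0 : 0 <= y by rewrite divr_ge0// ltW.
  have y1 : y <= 1 by rewrite ler_pdivrMr// mul1r.
  have yl : 1 - 4 * nn^-1 <= y.
    rewrite ler_pdivlMr// cdE.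
    have -> : (1 - 4 * nn^-1) * (nn * dd) = nn * dd - 4 * dd by field.
    by lra.
  have ee : `|e| <= 21 * nn^-1.
    have -> : e = 10 * N%:R ^- 2 - 11 * (N%:R ^- 2) ^+ 2.
      by rewrite /e /varprob -exprVn -!exprM; field; rewrite NE expf_neq0.
    have : (N%:R ^- 2) ^+ 2 <= N%:R ^- 2 :> R.
      by rewrite expr2 ler_piMr// (le_trans N2).
    have : 0 <= (N%:R ^- 2) ^+ 2 :> R by rewrite sqr_ge0.
    by move=> h1 h2; rewrite ler_norml; apply/andP; split; lra.
  have y2 : `|y ^+ 2 - 1| <= 8 * nn^-1.
    by rewrite ler_norml; apply/andP; split; nra.
  have y2e : `|y ^+ 2 * e| <= 21 * nn^-1.
    rewrite normrM (ger0_norm (sqr_ge0 y)); apply: le_trans ee.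
    by rewrite ler_piMl// expr_le1.
  apply: le_trans (ler_normD _ _) _; lra.
have B0 : 0 <= 29 :> R by [].
have h1 := crossX_clt sE rE N0 sd_factor_gt0 t0 t1 tn sE' cmu B0 var1 z.
have f01 (x : R) : 0 <= (((x - mu) / sigma <= z)%R%:R : R) <= 1.
  by case: (_ <= z); rewrite ?lexx ler01.
have h2 := mean_crossX_crossings sE N0 f01.
have h3 : n%:R ^+ 2 / N%:R = nn^-1 :> R by rewrite NE; field.
rewrite h3 in h2; rewrite /regular_const mulrDl mul1r -/t.
move: h1 h2; set a := mean _; set b := mean _; move=> h1 h2.
have -> : b - Phi z = (a - Phi z) - (a - b) by ring.
apply: le_trans (ler_normB _ _) _; lra.
Qed.

End FixedGraph.
End RegularCLT.

(** * Random graphs *)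

Lemma probability_finite_value (R : realType) (dT : measure_display)
    (T : measurableType dT) (P : probability T R) (U : finType) (Y : T -> U)
    (B : pred U) : (forall u, measurable (Y @^-1` [set u])) ->
  P [set w | B (Y w)] = (\sum_(u | B u) P (Y @^-1` [set u]))%E.
Proof.
move=> mY.
have -> : [set w | B (Y w)] = \bigcup_(u in [set u | B u]) (Y @^-1` [set u]).
  apply/seteqP; split=> [w Bw|w [u Bu]]; first by exists (Y w).
  by rewrite /preimage /= => ->.
rewrite measure_fin_bigcup//; first last.
- by move=> u v _ _ [w [/= <- <-]].
- exact: finite_finset.
rewrite (fsbig_fwiden (enum B)) ?enum_uniq//=.
- by rewrite big_enum.
- by move=> u Bu; rewrite /= mem_enum.
- by move=> u [/= + nBu]; rewrite mem_enum => /nBu.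
Qed.

Section RandomGraph.
Variables (R : realType) (n d : nat) (dT : measure_display)
  (T : measurableType dT) (P : probability T R) (X : {RV P >-> R}).
Local Notation A := (regular_graphs n d).

Lemma uniform_pair_prob (G : T -> {set 'I_n * 'I_n}) (p : T -> {perm 'I_n})
    (B : {set 'I_n * 'I_n} -> {perm 'I_n} -> bool) :
  uniform_on P A G -> uniform_on P [set: {perm 'I_n}]%SET p ->
  independent_finite P G p ->
  P [set w | B (G w) (p w)] =
  ((\sum_(E in A) mean (fun q => (B E q)%:R)) / #|A|%:R)%:E.
Proof.
move=> uG up ind.
have fib E q : (fun w => (G w, p w)) @^-1` [set (E, q)] =
    G @^-1` [set E] `&` p @^-1` [set q].
  by apply/seteqP; split=> [w [<- <-]|w [/= <- <-]].
rewrite (probability_finite_value (Y := fun w => (G w, p w))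
  P (fun x => B x.1 x.2)); last first.
  by case=> E q; rewrite fib; apply: measurableI; [case: (uG E)|case: (up q)].
transitivity (\sum_(x | B x.1 x.2)
    ((if x.1 \in A then #|A|%:R^-1 else 0) * #|{perm 'I_n}|%:R^-1 : R)%:E)%E.
  apply: eq_bigr => -[E q] _; rewrite fib ind.
  have [_ ->] := uG E; have [_ ->] := up q.
  by rewrite finset.in_setT cardsT -EFinM.
rewrite sumEFin; congr (_%:E).
rewrite mulr_suml big_mkcond [RHS]big_mkcond /=.
rewrite -(pair_bigA _ (fun E q => if B E q then
   (if E \in A then #|A|%:R^-1 else 0) * #|{perm 'I_n}|%:R^-1 else 0)) /=.
apply: eq_bigr => E _; case: ifP => EA; last first.
  by rewrite big1// => q _; case: ifP => // _; rewrite mul0r.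
rewrite /mean -mulrA mulr_suml; apply: eq_bigr => q _.
by case: (B E q); rewrite ?mul0r ?mul1r 1?mulrC.
Qed.

Hypotheses (hd : (1 <= d)%N) (hn : (2 * d < n)%N).
Hypothesis hX : random_regular_crossings n d X.
Local Notation mu := (crossing_mean R n d).
Local Notation sigma := (crossing_sd R n d).

(** The law of X is a mixture over the regular graphs of the laws treated in
    [regular_clt].  There is at least one regular graph, since otherwise all
    values of the random graph would have probability 0. *)
Lemma random_regular_clt z : exists q : R,
  P [set w | (X w - mu) / sigma <= z] = q%:E /\
  `|q - Phi z| <= regular_const R d / Num.sqrt n%:R.
Proof.
case: hX => G [p [uG up ind XE]].
have e := uniform_pair_prob (fun E q => ((crossings E q)%:R - mu) / sigma <= z) uG up ind.
have A0 : #|A|%:R != 0 :> R.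
  apply/negP => /eqP A0; have := uniform_pair_prob (fun _ _ => true) uG up ind.
  rewrite A0 invr0 mulr0 (_ : [set w | _] = setT).
    by rewrite probability_setT => /eqP; rewrite eqe oner_eq0.
  by apply/seteqP; split.
have [q qE] : exists q : R, q = (\sum_(E in A)
  mean (fun q => ((((crossings E q)%:R - mu) / sigma <= z)%R)%:R)) / #|A|%:R by eexists.
exists q; split.
  rewrite qE -e; congr (P _); apply/seteqP; split=> w /=; by rewrite XE.
have -> : q - Phi z = (\sum_(E in A)
  (mean (fun q => ((((crossings E q)%:R - mu) / sigma <= z)%R)%:R) - Phi z)) / #|A|%:R.
  by rewrite qE sumrB sumr_const -(mulr_natl (Phi z)); field.
set b := _ / Num.sqrt _.
have Apos : 0 < #|A|%:R :> R by rewrite lt0r A0 ler0n.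
rewrite normrM (ger0_norm (_ : 0 <= #|A|%:R^-1)) ?invr_ge0// ler_pdivrMr//.
apply: le_trans (ler_norm_sum _ _ _) _.
apply: (@le_trans _ _ (\sum_(E in A) b)); last by rewrite sumr_const mulr_natr.
apply: ler_sum => E; rewrite inE => /andP[sE /forallP rE].
by apply: regular_clt => // v; apply/eqP.
Qed.

End RandomGraph.

Lemma rate_vanishes (R : realType) (C e : R) : 0 < e ->
  exists M : nat, forall n : nat, (M <= n)%N -> C / Num.sqrt n%:R <= e.
Proof.
move=> e0; pose x := (`|C| / e) ^+ 2.
have x0 : 0 <= x by exact: sqr_ge0.
exists (Num.bound x).+1 => n Mn.
have n0 : 0 < Num.sqrt (n%:R : R) by rewrite sqrtr_gt0 ltr0n (leq_ltn_trans _ Mn).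
rewrite ler_pdivrMr//; apply: le_trans (ler_norm _) _.
rewrite mulrC -ler_pdivrMr// -(@ger0_norm _ (`|C| / e)) ?divr_ge0 ?(ltW e0)//.
rewrite -sqrtr_sqr ler_wsqrtr//; apply: le_trans (ltW (archi_boundP x0)) _.
by rewrite ler_nat ltnW.
Qed.

Theorem mainTheorem13 (R : realType) (d : nat) (hd : (1 <= d)%N) :
  (exists C : R, forall n : nat, (2 * d < n)%N -> ~~ odd (n * d) ->
    forall (d1 : measure_display) (T1 : measurableType d1)
      (P1 : probability T1 R) (X : {RV P1 >-> R})
      (d2 : measure_display) (T2 : measurableType d2)
      (P2 : probability T2 R) (Z : {RV P2 >-> R}),
      random_regular_crossings n d X ->
      normal_law Z (crossing_mean R n d) (crossing_sd R n d) ->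
      (kolmogorov_distance X Z <= (C / Num.sqrt n%:R)%:E)%E)
  /\
  (forall (N : nat -> nat),
    (forall k, (2 * d < N k)%N /\ ~~ odd (N k * d)) ->
    N k @[k --> \oo] --> \oo ->
    forall (dT : nat -> measure_display)
      (T : forall k, measurableType (dT k))
      (P : forall k, probability (T k) R)
      (X : forall k, {RV (P k) >-> R}),
      (forall k, random_regular_crossings (N k) d (X k)) ->
      forall x : R,
        P k [set w | (X k w - crossing_mean R (N k) d)
                       / crossing_sd R (N k) d <= x] @[k --> \oo]
          --> normal_prob 0 1 `]-oo, x]).
Proof.
split.
  exists (regular_const R d) => n hn _ d1 T1 P1 X d2 T2 P2 Z hX hZ.
  apply: ge_ereal_sup => _ [x _ <-].
  have sd0 := crossing_sd_gt0 R hd hn.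
  have [q [qE qb]] := random_regular_clt hd hn hX ((x - crossing_mean R n d) / crossing_sd R n d).
  have -> : cdf X x = q%:E.
    rewrite -qE /cdf /distribution /pushforward; congr (P1 _).
    apply/seteqP; split=> w; rewrite /preimage /= in_itv /=;
    by rewrite ler_pM2r ?invr_gt0// lerD2r.
  have -> : cdf Z x = (Phi ((x - crossing_mean R n d) / crossing_sd R n d))%:E.
    by rewrite /cdf hZ// ncdfE ncdf_scale.
  by rewrite -EFinB /= lee_fin.
move=> N hN Noo dT T P X hX x.
rewrite ncdfE -/(Phi x).
have /choice [q qP] k := random_regular_clt hd (hN k).1 (hX k) x.
rewrite (_ : (fun k => _) = (fun k => (q k)%:E)); last first.
  by apply/funext => k; rewrite (qP k).1.
apply: cvg_EFin; first exact: nearW.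
apply/cvgrPdist_le => e e0.
have [M hM] := rate_vanishes (regular_const R d) e0.
have h : \forall k \near \oo, (M <= N k)%N := Noo _ (nbhs_infty_ge M).
by apply: filterS h => k Mk; rewrite distrC (le_trans (qP k).2)// hM.
Qed.
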